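(* Let $\kappa$ be a regular cardinal and $\mu>\kappa$ a cardinal with $\operatorname{cf}(\mu)<\kappa$. Suppose that $\operatorname{cf}([\lambda]^{<\kappa},\subseteq)=\lambda$ for cofinally many $\lambda<\mu$, and that $\Box^{***}_{\kappa,\mu}$ holds. Then for every sufficiently large regular $\chi$ and every $x\in\mathcal{H}(\chi)$ there is a $(\kappa,\mu)$-Jensen matrix over $x$.
   Context: $\mathcal{H}(\chi)$ is the set of sets hereditarily of cardinality $<\chi$; $[X]^{<\kappa}=\{Y\subseteq X:|Y|<\kappa\}$; $\operatorname{cf}$ of a partial order is the least size of a cofinal subset. $\Box^{***}_{\kappa,\mu}$ (for $\kappa$ regular, $\mu>\kappa$): there are a sequence $(C_\alpha)_{\alpha<\mu^+}$ and a club $D\subseteq\mu^+$ such that for every $\alpha\in D$ with $\operatorname{cf}(\alpha)\geq\kappa$: $C_\alpha\subseteq\alpha$ is unbounded in $\alpha$, and every $x\in[C_\alpha]^{<\kappa}$ is a subset of some $C_{\alpha'}$ with $\alpha'<\alpha$ and $|C_{\alpha'}|<\kappa$. Let $\mu^*=\operatorname{cf}(\mu)$. A $(\kappa,\mu)$-Jensen matrix over $x\in\mathcal{H}(\chi)$ is a sequence $(M_{\alpha,\beta})_{\alpha<\mu^+,\beta<\mu^*}$ such that: (j1) each $M_{\alpha,\beta}$ is an elementary submodel of $(\mathcal{H}(\chi),\in)$, $x\in M_{\alpha,\beta}$, $\kappa+1\subseteq M_{\alpha,\beta}$ and $|M_{\alpha,\beta}|<\mu$; (j2) for each $\alpha<\mu^+$,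 $(M_{\alpha,\beta})_{\beta<\mu^*}$ is increasing; (j3) if $\alpha<\mu^+$ and $\operatorname{cf}(\alpha)\geq\kappa$, then there is $\beta^*<\mu^*$ such that for every $\beta$ with $\beta^*\leq\beta<\mu^*$, $[M_{\alpha,\beta}]^{<\kappa}\cap M_{\alpha,\beta}$ is cofinal in $([M_{\alpha,\beta}]^{<\kappa},\subseteq)$; (j4) letting $M_\alpha=\bigcup_{\beta<\mu^*}M_{\alpha,\beta}$, the sequence $(M_\alpha)_{\alpha<\mu^+}$ is continuously increasing and $\mu^+\subseteq\bigcup_{\alpha<\mu^+}M_\alpha$. *)

(* Defs.v *)
From mathcomp Require Import all_boot.
From mathcomp Require Import boolp classical_sets functions cardinality.
From Stdlib Require Import Relation_Operators.

Set Implicit Arguments.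
Unset Strict Implicit.
Unset Printing Implicit Defensive.

Local Open Scope classical_set_scope.
Local Open Scope card_scope.

Reserved Notation "x ∈ y" (at level 70, no associativity).
Reserved Notation "x ⊆ y" (at level 70, no associativity).

(* A universe of sets: a model of ZFC whose separation and replacement range
   over all predicates and functions of the metatheory, so that its natural
   numbers, its functions between sets and its cardinalities are those of the
   metatheory.  Choice is not listed: it follows from the other axioms and the
   choice axiom of [boolp].  The lemma [universe_exists] at the end of the file
   gives such a universe. *)
Record universe := Universe {
  carrier :> Type ;
  mem_set : carrier -> carrier -> Prop where "x ∈ y" := (mem_set x y) ;
  extensionality : forall x y, (forall z, z ∈ x <-> z ∈ y) -> x = y ;
  foundation : well_founded mem_set ;
  pairing : forall x y, exists p, forall z, z ∈ p <-> z = x \/ z = y ;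
  union : forall x, exists u, forall z, z ∈ u <-> exists2 y, y ∈ x & z ∈ y ;
  powerset : forall x, exists p, forall y,
    y ∈ p <-> (forall z, z ∈ y -> z ∈ x) ;
  infinity : exists w,
    (exists2 e, e ∈ w & forall z, ~ z ∈ e) /\
    (forall x, x ∈ w -> exists2 s, s ∈ w & forall z, z ∈ s <-> z ∈ x \/ z = x) ;
  separation : forall (P : carrier -> Prop) x, exists s, forall z,
    z ∈ s <-> z ∈ x /\ P z ;
  replacement : forall (F : carrier -> carrier) x, exists r, forall y,
    y ∈ r <-> exists2 z, z ∈ x & y = F z
}.

Notation "x ∈ y" := (mem_set x y).

Definition elts (V : universe) (x : V) : set V := [set y | y ∈ x].

Definition subset_of (V : universe) (x y : V) : Prop := elts x `<=` elts y.
Notation "x ⊆ y" := (subset_of x y).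

Section Cardinals.
Variable V : universe.
Implicit Types (a b c k l m x y : V) (A B P X : set V).

Definition card_lt A B : Prop := A #<= B /\ ~ (B #<= A).

Definition transitive_set x : Prop := forall y, y ∈ x -> y ⊆ x.

(* von Neumann ordinals; on them [∈] is [<] and [⊆] is [<=] *)
Definition is_ordinal a : Prop :=
  transitive_set a /\ forall b, b ∈ a -> transitive_set b.

Definition is_limit a : Prop :=
  [/\ is_ordinal a, elts a !=set0 & forall b, b ∈ a -> exists2 c, c ∈ a & b ∈ c].

(* cardinals are initial ordinals *)
Definition is_cardinal k : Prop :=
  is_ordinal k /\ forall a, a ∈ k -> card_lt (elts a) (elts k).

Definition is_successor_cardinal m mplus : Prop :=
  [/\ is_cardinal mplus, m ∈ mplus &
      forall l, is_cardinal l -> m ∈ l -> mplus ⊆ l].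

Definition cofinal P (le : V -> V -> Prop) X : Prop :=
  X `<=` P /\ forall p, P p -> exists2 q, X q & le p q.

(* [c] is the cofinality of the partial order [(P, le)] *)
Definition is_cof P (le : V -> V -> Prop) c : Prop :=
  [/\ is_cardinal c,
      exists2 X, cofinal P le X & X #= elts c &
      forall X, cofinal P le X -> elts c #<= X].

Definition is_cf a c : Prop := is_cof (elts a) (@subset_of V) c.

Definition cf_ge a k : Prop := exists2 c, is_cf a c & k ⊆ c.

Definition is_regular k : Prop :=
  [/\ is_cardinal k, infinite_set (elts k) & is_cf k k].

(* [x]^{<k} *)
Definition subsets_lt x k : set V :=
  [set y | y ⊆ x /\ card_lt (elts y) (elts k)].

Definition trcl x : set V := [set y | clos_trans V (@mem_set V) y x].

Definition H_ k : set V := [set x | card_lt (trcl x) (elts k)].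

Definition is_club D a : Prop :=
  cofinal (elts a) (@subset_of V) D /\
  forall d, d ∈ a -> is_limit d ->
    cofinal (elts d) (@subset_of V) (D `&` elts d) -> D d.

End Cardinals.

(* First-order formulas of the language of set theory, with de Bruijn
   indices for the variables. *)
Inductive formula : Type :=
| FEq of nat & nat
| FMem of nat & nat
| FFalse
| FImp of formula & formula
| FAll of formula.

Definition env_cons (T : Type) (x : T) (e : nat -> T) (n : nat) : T :=
  if n is n'.+1 then e n' else x.

Fixpoint sat (V : universe) (D : set V) (e : nat -> V) (f : formula) : Prop :=
  match f with
  | FEq i j => e i = e j
  | FMem i j => e i ∈ e j
  | FFalse => False
  | FImp f g => sat D e f -> sat D e g
  | FAll f => forall x, D x -> sat D (env_cons x e) f
  end.

Definition elementary_submodel (V : universe) (M N : set V) : Prop :=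
  [/\ M !=set0, M `<=` N &
      forall (f : formula) (e : nat -> V), (forall i, M (e i)) ->
        (sat M e f <-> sat N e f)].

Section Jensen.
Variable V : universe.
Implicit Types (k m mplus mstar chi x : V).

(* [mplus] stands for the successor cardinal of the cardinal [m] of the
   principle.  A sequence indexed by a set is a function on [V] of which only
   the values on the index set are used. *)
Definition square3 k mplus : Prop :=
  exists (C : V -> V) (D : set V), is_club D mplus /\
    forall a, D a -> cf_ge a k ->
      cofinal (elts a) (@subset_of V) (elts (C a)) /\
      forall x, subsets_lt (C a) k x ->
        exists2 a', a' ∈ a & x ⊆ C a' /\ card_lt (elts (C a')) (elts k).

(* [mplus] and [mstar] stand for the successor and the cofinality of [m].
   Increasing means weakly increasing for inclusion. *)
Definition Jensen_matrix k m mplus mstar chi x (M : V -> V -> V) : Prop :=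
  let Mrow a : set V := \bigcup_(b in elts mstar) elts (M a b) in
  [/\
      forall a b, a ∈ mplus -> b ∈ mstar ->
        [/\ elementary_submodel (elts (M a b)) (H_ chi), x ∈ M a b,
            elts k `|` [set k] `<=` elts (M a b) &
            card_lt (elts (M a b)) (elts m)],
      forall a b b', a ∈ mplus -> b' ∈ mstar -> b ∈ b' -> M a b ⊆ M a b',
      forall a, a ∈ mplus -> cf_ge a k ->
        exists2 b0, b0 ∈ mstar & forall b, b ∈ mstar -> b0 ⊆ b ->
          cofinal (subsets_lt (M a b) k) (@subset_of V)
                  (subsets_lt (M a b) k `&` elts (M a b)) &
      [/\ forall a a', a' ∈ mplus -> a ∈ a' -> Mrow a `<=` Mrow a',
          forall a, a ∈ mplus -> is_limit a ->
            Mrow a = \bigcup_(a' in elts a) Mrow a' &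
          elts mplus `<=` \bigcup_(a in elts mplus) Mrow a]].

End Jensen.

(* Aczel's trees, quotiented by extensional equality: the elements of the
   quotient are the equivalence classes. *)
Inductive tree : Type := Sup (A : Type) (f : A -> tree).

Fixpoint teq (x y : tree) : Prop :=
  let: Sup A f := x in let: Sup B g := y in
  (forall a, exists b, teq (f a) (g b)) /\ (forall b, exists a, teq (f a) (g b)).

Lemma teq_refl x : teq x x.
Proof. by elim: x => A f IH /=; split=> a; exists a. Qed.

Lemma teq_sym x y : teq x y -> teq y x.
Proof.
elim: x y => A f IH [B g] /= [fg gf]; split=> c.
  by have [a /IH h] := gf c; exists a.
by have [b /IH h] := fg c; exists b.
Qed.

Lemma teq_trans x y z : teq x y -> teq y z -> teq x z.
Proof.
elim: x y z => A f IH [B g] [C h] /= [fg gf] [gh hg]; split=> c.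
  by have [b fb] := fg c; have [d gd] := gh b; exists d; apply: IH gd.
by have [b gb] := hg c; have [a fa] := gf b; exists a; apply: IH gb.
Qed.

Definition tclass : Type := {P : tree -> Prop | exists x, P = teq x}.

Definition cls (x : tree) : tclass := exist _ (teq x) (ex_intro _ x erefl).

Definition rep (c : tclass) : tree := projT1 (cid (projT2 c)).

Lemma repK c : cls (rep c) = c.
Proof.
apply/eq_sig_hprop => [P|/=]; first exact: Prop_irrelevance.
by rewrite /rep; case: (cid _).
Qed.

Lemma clsP x y : cls x = cls y <-> teq x y.
Proof.
split=> [[e]|xy]; first by rewrite e; apply: teq_refl.
apply/eq_sig_hprop => [P|/=]; first exact: Prop_irrelevance.
apply/funext => z; apply/propext.
by split; apply: teq_trans => //; apply: teq_sym.
Qed.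

Definition cmem (c d : tclass) : Prop :=
  let: Sup B g := rep d in exists b, c = cls (g b).

Lemma cmemE c B g : cmem c (cls (@Sup B g)) <-> exists b, c = cls (g b).
Proof.
rewrite /cmem; have := repK (cls (Sup g)).
case: (rep _) => A f /clsP /= [fg gf]; split=> -[i ->].
  by have [b /clsP ?] := fg i; exists b.
by have [a /clsP ?] := gf i; exists a.
Qed.

Lemma cls_ind (P : tclass -> Prop) :
  (forall (A : Type) (f : A -> tree), P (cls (Sup f))) -> forall c, P c.
Proof. by move=> h c; rewrite -(repK c); case: (rep c). Qed.

Definition cfam (A : Type) (F : A -> tclass) : tclass :=
  cls (Sup (fun a => rep (F a))).

Lemma cfamE A (F : A -> tclass) c : cmem c (cfam F) <-> exists a, c = F a.
Proof. by rewrite cmemE; split=> -[a ->]; exists a; rewrite repK. Qed.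

Lemma universe_exists : inhabited universe.
Proof.
constructor; apply: (@Universe tclass cmem).
- elim/cls_ind=> A f; elim/cls_ind=> B g e; apply/clsP; split=> [a|b].
    have [+ _] := e (cls (f a)); rewrite !cmemE => -[|b /clsP ?]; last by exists b.
    by exists a.
  have [_ +] := e (cls (g b)); rewrite !cmemE => -[|a /clsP/teq_sym ?].
    by exists b.
  by exists a.
- move=> c; rewrite -(repK c); elim: (rep c) => A f IH.
  by constructor=> d /cmemE[a ->].
- move=> x y; exists (cfam (fun b : bool => if b then x else y)) => z.
  rewrite cfamE; split=> [[[] ->]|[] ->]; [by left|by right| |].
    by exists true.
  by exists false.
- elim/cls_ind=> A f.
  pose ix t := let: Sup B _ := t in B.
  pose sub t : ix t -> tree := let: Sup B g := t in g.
  exists (cfam (fun p : {a : A & ix (f a)} =>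
                  cls (@sub (f (projT1 p)) (projT2 p)))) => z.
  rewrite cfamE; split=> [[[a i] -> /=]|[y /cmemE[a ->]]].
    exists (cls (f a)); first by rewrite cmemE; exists a.
    by case: (f a) i => B g i /=; rewrite cmemE; exists i.
  case E : (f a) => [B g] /cmemE[b ->].
  have [i ->] : exists i : ix (f a), cls (g b) = cls (@sub (f a) i).
    by rewrite E; exists b.
  by exists (existT _ a i).
- elim/cls_ind=> A f.
  exists (cfam (fun P : A -> Prop =>
                  cfam (fun p : {a | P a} => cls (f (sval p))))) => y.
  rewrite cfamE; split=> [[P -> z /cfamE[[a Pa] ->]]|yf].
    by rewrite cmemE; exists a.
  exists (fun a => cmem (cls (f a)) y); move: yf; elim/cls_ind: y => B g yf.
  apply/clsP; split=> [b|[a ya]] /=.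
    have /yf : cmem (cls (g b)) (cls (Sup g)) by rewrite cmemE; exists b.
    rewrite cmemE => -[a e].
    have ya : cmem (cls (f a)) (cls (Sup g)) by rewrite cmemE; exists b.
    by exists (exist _ a ya); apply/clsP; rewrite repK.
  have [b e] := (cmemE _ _).1 ya.
  by exists b; apply/clsP; rewrite repK.
- pose s c := let: Sup A f := rep c in
    cfam (fun o : option A => if o is Some a then cls (f a) else c).
  have sE c z : cmem z (s c) <-> cmem z c \/ z = c.
    rewrite /s {2}/cmem; case: (rep c) => A f; rewrite cfamE.
    split=> [[[a|] ->]|[[a ->]|->]]; [by left; exists a|by right| |].
      by exists (Some a).
    by exists None.
  pose e := cfam (fun i : False => match i return tclass with end).
  exists (cfam (fun n : nat => iter n s e)); split.
    by exists e; [rewrite cfamE; exists 0 | move=> z /cfamE[]].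
  move=> x /cfamE[n ->]; exists (s (iter n s e)) => //.
  by rewrite cfamE; exists n.+1.
- move=> P; elim/cls_ind=> A f.
  exists (cfam (fun p : {a | P (cls (f a))} => cls (f (sval p)))) => z.
  rewrite cfamE cmemE; split=> [[[a Pa] -> /=]|[[a ->] Pa]].
    by split=> //; exists a.
  by exists (exist _ a Pa).
- move=> F; elim/cls_ind=> A f.
  exists (cfam (fun a => F (cls (f a)))) => y; rewrite cfamE.
  split=> [[a ->]|[z /cmemE[a ->] ->]]; last by exists a.
  by exists (cls (f a)) => //; rewrite cmemE; exists a.
Qed.

(* Main.v *)
(* Enumerate the members of the club [D] above [mu] increasingly and continuously
   as [delta a], [a < mu+], and fix a sequence [lam b], [b < cf mu], cofinal in
   [mu], of cardinals with [cf ([lam b]^{<kappa}) = lam b].  The model [M a b] is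
   the hull of [lam b + 1] and of a subset of [delta a] of size less than [mu];
   the union over [b] is the hull of [delta a], whence continuity.  The hull is
   taken under Skolem functions of [H_ chi], under enumerations of sets, and under
   operations [cover xi l i g], [xi < kappa], returning the hull, under the
   operations of index below [xi], of a small set coded by [l], [i], [g]: the
   [i]-th member of a cofinal family in [[l]^{<kappa}], and [C g].  A small subset
   [y] of [M a b] is generated by small parts of [lam b] and of [delta a] through
   operations of bounded index.  If [cf a >= kappa], the generators in [delta a]
   are taken in a cofinal subset of [C (delta a)], whose small subsets lie in sets
   [C g] with [g < delta a]; because [cf mu < kappa], such [g] can be found in
   [M a b] as soon as [b] is large enough.  So some [cover xi l i g] in [M a b]
   contains [y]. *)
Require Import Defs.
From mathcomp Require Import all_boot.
From mathcomp Require Import boolp classical_sets functions cardinality.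
From Stdlib Require Import Relation_Operators.

Set Implicit Arguments.
Unset Strict Implicit.
Unset Printing Implicit Defensive.

Local Open Scope classical_set_scope.
Local Open Scope card_scope.

(** * Cardinal arithmetic *)

Section CardinalArithmetic.
Implicit Types T U I : Type.

Lemma set_inj_card_le T U (f : T -> U) (A : set T) (B : set U) :
  (forall x, A x -> B (f x)) ->
  (forall x y, A x -> A y -> f x = f y -> x = y) -> A #<= B.
Proof.
move=> fAB finj; apply: (@card_le_trans _ _ _ (f @` A)).
  have /card_eqPle[] : f @` A #= A.
    by apply: inj_card_eq => x y /set_mem Ax /set_mem Ay; exact: finj.
  by [].
by apply: subset_card_le => _ [x Ax <-]; exact: fAB.
Qed.

(** Choice extracts an injection from [R]. The Zorn arguments below produce graphs rather than
    functions. *)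
Lemma rel_card_le T U (R : T -> U -> Prop) (A : set T) (B : set U) :
  (forall x, A x -> exists2 y, B y & R x y) ->
  (forall x x' y, A x -> A x' -> R x y -> R x' y -> x = x') -> A #<= B.
Proof.
move=> Rtot Rinj.
have [->|/set0P[x0 Ax0]] := eqVneq A set0; first exact: card_ge0.
have [y0 By0 _] := Rtot _ Ax0.
have /choice[f fP] : forall x, exists y, A x -> B y /\ R x y.
  move=> x; have [Ax|nAx] := pselect (A x); last by exists y0.
  by have [y By Rxy] := Rtot _ Ax; exists y.
apply: (set_inj_card_le (f := f)) => [x /fP[]//|x y Ax Ay fxy].
by apply: (Rinj _ _ (f x)) => //; [case: (fP _ Ax)|rewrite fxy; case: (fP _ Ay)].
Qed.

Lemma card_leE T U (A : set T) (B : set U) (u0 : U) : A #<= B ->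
  exists f : T -> U, (forall x, A x -> B (f x)) /\
    (forall x y, A x -> A y -> f x = f y -> x = y).
Proof.
move=> /card_leP[g].
pose f x := if pselect (A x) is left h then val (g (exist _ x (mem_set h))) else u0.
exists f; split=> [x Ax|x y Ax Ay]; rewrite /f; case: pselect => // hx.
  by apply: set_mem; exact: valP.
case: pselect => // hy /val_inj/inj; rewrite !in_setT => /(_ isT isT).
by case.
Qed.

(** Zorn's lemma on the graphs of partial injections from [A] to [B]: one that misses a point on
    each side is not maximal, since the pair of these points can be added. *)
Lemma card_le_total T U (A : set T) (B : set U) : A #<= B \/ B #<= A.
Proof.
pose P (G : set (T * U)) :=
  (forall p, G p -> A p.1 /\ B p.2) /\
  (forall p q, G p -> G q -> (p.1 = q.1 <-> p.2 = q.2)).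
have [|G [[GAB Ginj] Gmax]] := @Zorn_bigcup _ P.
  move=> F FP Ftot; split=> [p [G FG Gp]|p q [G FG Gp] [G' FG' G'q]].
    by have [h _] := FP _ FG; exact: h.
  have [_ h] := FP _ FG; have [_ h'] := FP _ FG'.
  have [s|s] := Ftot _ _ FG FG'; [apply: h' => //|apply: h => //]; exact: s.
have [full|/existsNP[a /not_implyP[Aa na]]] :=
    pselect (forall a, A a -> exists b, G (a, b)).
  left; apply: (rel_card_le (R := fun a b => G (a, b))) => [a /full[b Gb]|a a' b _ _ h h'].
    by exists b => //; have [] := GAB _ Gb.
  by apply/(Ginj _ _ h h').
have [full|/existsNP[b /not_implyP[Bb nb]]] :=
    pselect (forall b, B b -> exists a, G (a, b)).
  right; apply: (rel_card_le (R := fun b a => G (a, b))) => [b /full[a' Gb]|b b' a' _ _ h h'].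
    by exists a' => //; have [] := GAB _ Gb.
  by apply/(Ginj _ _ h h').
case: (Gmax (G `|` [set (a, b)])).
  split; first by left.
  by move=> /(_ (a, b)) h; case: na; exists b; apply: h; right.
split=> [p [/GAB//|->//]|[x y] [x' y'] [Gp|[-> ->]] [Gq|[-> ->]]] //=.
- exact: (Ginj _ _ Gp Gq).
- split=> e; [case: na; exists y|case: nb; exists x]; by rewrite -e.
- split=> e; [case: na; exists y'|case: nb; exists x']; by rewrite e.
Qed.

Lemma card_le_nonempty T U (A : set T) (B : set U) x :
  A x -> A #<= B -> exists y, B y.
Proof.
move=> Ax; have [->|/set0P//] := eqVneq B set0.
by rewrite card_le0 => /eqP A0; rewrite A0 in Ax.
Qed.

Lemma card_leX T T' U U' (A : set T) (A' : set T') (B : set U) (B' : set U') :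
  A #<= B -> A' #<= B' -> A `*` A' #<= B `*` B'.
Proof.
move=> AB AB'.
have [A0|/set0P[[x x'] [/= Ax Ax']]] := eqVneq (A `*` A') set0.
  by rewrite A0; exact: card_ge0.
have [y By] := card_le_nonempty Ax AB; have [y' By'] := card_le_nonempty Ax' AB'.
have [f [fB fI]] := card_leE y AB; have [g [gB gI]] := card_leE y' AB'.
apply: (set_inj_card_le (f := fun p => (f p.1, g p.2))) => [[a b] [/=]|[a b] [c d] [/=] ? ? [/=] ? ? []].
  by split; [exact: fB|exact: gB].
by move=> /fI -> // /gI ->.
Qed.

(** A point of the union is coded by a pair over [K]: the number of a piece containing it and its
    number inside that piece. *)
Lemma card_bigcup_le T U I (D : set I) (F : I -> set T) (K : set U) :
  K `*` K #<= K -> D #<= K -> (forall i, D i -> F i #<= K) ->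
  \bigcup_(i in D) F i #<= K.
Proof.
move=> KK DK FK; apply: card_le_trans KK.
have [D0|/set0P[t [i0 Di0 Ft]]] := eqVneq (\bigcup_(i in D) F i) set0.
  by rewrite D0; exact: card_ge0.
have [k0 _] := card_le_nonempty Di0 DK.
have [g [gK gI]] := card_leE k0 DK.
have /choice[f fP] : forall i, exists f : T -> U, D i ->
   (forall x, F i x -> K (f x)) /\
   (forall x y, F i x -> F i y -> f x = f y -> x = y).
  move=> i; have [Di|nDi] := pselect (D i); last by exists (fun=> k0).
  by have [f fP] := card_leE k0 (FK _ Di); exists f.
apply: (rel_card_le (R := fun x p => exists i, [/\ D i, F i x & p = (g i, f i x)])).
  move=> x [i Di Fx]; exists (g i, f i x); last by exists i.
  by split=> /=; [exact: gK|case: (fP _ Di) => h _; exact: h].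
move=> x x' p _ _ [i [Di Fx ->]] [j [Dj Fx' [/gI e]]].
move: Dj Fx' => /[swap]; move=> + Dj; rewrite -e // => Fx' /(fP _ Di).2; exact.
Qed.

(* Zorn's lemma on the partial injections [X * X -> X] with [X] a subset of [A],
   given as relations that extend one with [X] countably infinite. *)
Theorem card_squared T (A : set T) : infinite_set A -> A `*` A #<= A.
Proof.
move=> /infiniteP natA.
have [t0 _] := card_le_nonempty (x := 0) I natA.
have [e [eA eI]] := card_leE t0 natA.
have /card_eqPle[/(card_leE 0)[c [_ cI]] _] := card_nat2.
pose G0 : set (T * T * T) :=
  [set p | exists i j, p = (e i, e j, e (c (i, j)))].
pose X (G : set (T * T * T)) := [set x | exists z, G (x, x, z)].
pose ok (G : set (T * T * T)) :=
  [/\ forall x y z, G (x, y, z) -> [/\ X G x, X G y, X G z & [/\ A x, A y & A z]],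
      forall x y, X G x -> X G y -> exists z, G (x, y, z) &
      forall x y x' y' z, G (x, y, z) -> G (x', y', z) -> (x, y) = (x', y')].
have XS G G' : G `<=` G' -> X G `<=` X G' by move=> s x [z /s]; exists z.
have okG0 : ok G0.
  have XG0 i : X G0 (e i) by exists (e (c (i, i))), i, i.
  split=> [x y z [i [j [-> -> ->]]]|x y|x y x' y' z [i [j [-> -> ->]]]].
  - by split=> //; split; exact: eA.
  - by move=> [z [i [j [-> _ _]]]] [z' [i' [j' [-> _ _]]]]; exists (e (c (i, i'))), i, i'.
  - by move=> [i' [j' [-> -> /eI]]] => /(_ I I)/(cI _ _ I I)[-> ->].
(* Requiring [ok] only after union with [G0] admits the empty relation, which is the union of the
   empty chain. *)
have [|G [[Gcl Gtot Ginj] Gmax]] := @Zorn_bigcup _ [set G | ok (G `|` G0)].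
  move=> F FP Ftot /=.
  have [->|/set0P[H0 FH0]] := eqVneq F set0; first by rewrite bigcup_set0 set0U.
  have sub H : F H -> H `|` G0 `<=` \bigcup_(X in F) X `|` G0.
    by move=> FH p [Hp|]; [left; exists H|right].
  have dir p q : (\bigcup_(X in F) X `|` G0) p -> (\bigcup_(X in F) X `|` G0) q ->
      exists2 H, F H & (H `|` G0) p /\ (H `|` G0) q.
    move=> [[H FH Hp]|G0p] [[H' FH' H'q]|G0q].
    - have [s|s] := Ftot _ _ FH FH'; [exists H'|exists H] => //; split; left => //; exact: s.
    - by exists H => //; split; [left|right].
    - by exists H' => //; split; [right|left].
    - by exists H0 => //; split; right.
  split=> [x y z Gp|x y [z Gz] [z' Gz']|x y x' y' z Gp Gq].
  - have [H FH [Hp _]] := dir _ _ Gp Gp.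
    have [h _ _] := FP _ FH; have [? ? ? ?] := h _ _ _ Hp.
    by split=> //; apply: XS; [exact: (sub _ FH)| |exact: (sub _ FH)| |exact: (sub _ FH)|].
  - have [H FH [Hp Hq]] := dir _ _ Gz Gz'.
    have [_ h _] := FP _ FH.
    have [|| w Hw] := h x y; [by exists z|by exists z'|].
    by exists w; apply: (sub _ FH).
  - have [H FH [Hp Hq]] := dir _ _ Gp Gq.
    by have [_ _ h] := FP _ FH; exact: h Hp Hq.
set G1 := G `|` G0 in Gcl Gtot Ginj; set B := X G1.
have BA : B `<=` A by move=> x [z /Gcl[_ _ _ []]].
have BB : B `*` B #<= B.
  apply: (rel_card_le (R := fun p z => G1 (p, z))) => [[x y] [/= Bx By]|[x y] [x' y'] z _ _].
    by have [z Gz] := Gtot _ _ Bx By; exists z => //; have [] := Gcl _ _ _ Gz.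
  exact: Ginj.
have eB i : B (e i).
  by exists (e (c (i, i))); right; exists i, i.
have boolB : [set: bool] #<= B.
  apply: (set_inj_card_le (f := fun b : bool => e b)) => [b _|b b' _ _ /eI] //.
  by move=> /(_ I I); case: b; case: b'.
have UB (C : set T) : C #<= B -> B `|` C #<= B.
  move=> CB; pose F (b : bool) := if b then B else C.
  apply: (@card_le_trans _ _ _ (\bigcup_(b in [set: bool]) F b)).
    by apply: subset_card_le => x [Bx|Cx]; [exists true|exists false].
  by apply: card_bigcup_le => // -[] _ //=; exact: card_lexx.
(* Either [A] embeds in [B], and the square of [B] settles the claim, or [A] has room outside [B]
   for a copy [C] of [B], and then [G] can be extended. *)
have [AB|BAB] := card_le_total (A `\` B) B.
  have {}AB : A #<= B.
    apply: card_le_trans (UB _ AB); apply: subset_card_le => x Ax.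
    by have [Bx|nBx] := pselect (B x); [left|right].
  exact: (card_le_trans (card_leX AB AB) (card_le_trans BB (subset_card_le BA))).
have [h [hA hI]] := card_leE t0 BAB.
pose C := h @` B.
have CB : C #<= B by exact: card_image_le.
have [k [kB kI]] :=
  card_leE t0 (card_le_trans (card_leX (UB _ CB) (UB _ CB)) BB).
(* The new pairs take their values in [C], away from the old values in [B], so the extension stays
   injective. *)
pose N : set (T * T * T) := [set p | exists x y, [/\ (B `|` C) x, (B `|` C) y,
  ~ (B x /\ B y) & p = (x, y, h (k (x, y)))]].
have C_notB x : C x -> ~ B x by move=> [b Bb <-]; case: (hA _ Bb).
have C_A x : C x -> A x by move=> [b Bb <-]; case: (hA _ Bb).
have kC x y : (B `|` C) x -> (B `|` C) y -> C (h (k (x, y))).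
  by move=> Ux Uy; exists (k (x, y)) => //; exact: kB.
have XN x : (B `|` C) x -> X ((G `|` N) `|` G0) x.
  move=> [[z [Gz|G0z]]|Cx]; [by exists z; left; left|by exists z; right|].
  exists (h (k (x, x))); left; right; exists x, x; split => //; try by right.
  by move=> [/C_notB-/(_ Cx)].
have NX x : X ((G `|` N) `|` G0) x -> (B `|` C) x.
  move=> [z [[Gz|[x' [y' [Ux _ _ [-> _ _]]]]]|G0z]] //; left; exists z; by [left|right].
case: (Gmax (G `|` N)).
  split; first by left.
  have Ch : C (h (e 0)) by exists (e 0).
  have Nh : N (h (e 0), h (e 0), h (k (h (e 0), h (e 0)))).
    exists (h (e 0)), (h (e 0)); split => //; try by right.
    by move=> [/C_notB-/(_ Ch)].
  move=> /(_ _ (or_intror Nh)) Gh.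
  have [Bh _ _ _] := Gcl _ _ _ (or_introl Gh).
  by case: (C_notB _ Ch).
have N1 p : ((G `|` N) `|` G0) p -> G1 p \/ N p.
  by move=> [[?|?]|?]; [left; left|right|left; right].
have UA x : (B `|` C) x -> A x by move=> [/BA|/C_A].
split=> [x y z /N1[/Gcl[Bx By Bz ?]|[x' [y' [Ux Uy _ [-> -> ->]]]]]|x y /NX Ux /NX Uy|].
- by split=> //; apply: XN; left.
- have Cz := kC _ _ Ux Uy.
  by split; [exact: XN|exact: XN|apply: XN; right|split; apply: UA => //; right].
- have [[Bx By]|nB] := pselect (B x /\ B y).
    have [z [Gz|Gz]] := Gtot _ _ Bx By; exists z; [by left; left|by right].
  by exists (h (k (x, y))); left; right; exists x, y.
move=> x y x' y' z /N1[Gp|[a [b [Ua Ub _ [-> -> ->]]]]] /N1[Gq|[a' [b' [Ua' Ub' _]]]].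
- exact: Ginj Gp Gq.
- move=> [_ _ e']; have [_ _ Bz _] := Gcl _ _ _ Gp.
  by case: (C_notB z) => //; rewrite e'; exact: kC.
- by have [_ _ Bz _] := Gcl _ _ _ Gq; case: (C_notB _ (kC _ _ Ua Ub)).
- move=> [-> -> /hI e']; apply: kI => //; apply: e'; exact: kB.
Qed.

Lemma card_setU_le T U (A B : set T) (K : set U) : infinite_set K ->
  A #<= K -> B #<= K -> A `|` B #<= K.
Proof.
move=> iK AK BK; pose F (b : bool) := if b then A else B.
apply: (@card_le_trans _ _ _ (\bigcup_(b in [set: bool]) F b)).
  by apply: subset_card_le => x [Bx|Cx]; [exists true|exists false].
apply: card_bigcup_le => [||[]//]; first exact: card_squared.
apply: card_le_trans ((infiniteP K).1 iK); exact: countableP.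
Qed.
End CardinalArithmetic.

(** * Sets, ordinals and cofinalities inside a universe *)

Section SetTheory.
Variable V : universe.
Implicit Types (a b c d k x y z : V) (A B X : set V).

Lemma elts_inj x y : elts x = elts y -> x = y.
Proof.
move=> e; apply: Defs.extensionality => z.
by rewrite -[z ∈ x]/(elts x z) -[z ∈ y]/(elts y z) e.
Qed.

Lemma subset_anti x y : x ⊆ y -> y ⊆ x -> x = y.
Proof. by move=> xy yx; apply: elts_inj; apply/seteqP. Qed.

(** A total function: a class that is not a set gets an arbitrary value. *)
Definition of_set A : V :=
  if pselect (exists z, elts z = A) is left h then projT1 (cid h)
  else projT1 (cid (infinity V)).

Lemma of_setE A : (exists z, elts z = A) -> elts (of_set A) = A.
Proof. by move=> h; rewrite /of_set; case: pselect => // {}h; case: cid. Qed.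

Lemma of_set_sub A x : A `<=` elts x -> elts (of_set A) = A.
Proof.
move=> Ax; apply: of_setE; have [s sP] := separation A x.
by exists s; apply/seteqP; (split=> z; rewrite /elts /= sP) => [[]//|Az]; split=> //; exact: Ax.
Qed.

(** Replacement, applied to a left inverse of an injection of [A] into [x]. *)
Lemma of_set_small A x : A #<= elts x -> elts (of_set A) = A.
Proof.
have [->|/set0P[a0 Aa0] Ax] := eqVneq A set0; first by move=> _; exact: (@of_set_sub _ x).
have [f [fx fI]] := card_leE x Ax.
have /choice[g gP] : forall z, exists a, A a /\ forall b, A b -> f b = z -> a = b.
  move=> z; have [[a Aa <-]|nz] := pselect (exists2 a, A a & f a = z).
    by exists a; split=> // b Ab /fI->.
  by exists a0; split=> // b Ab e; case: nz; exists b.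
apply: of_setE; have [r rP] := replacement g x; exists r.
apply/seteqP; (split=> z; rewrite /elts /= rP) => [[y _ ->]|Az]; first by case: (gP y).
by exists (f z); [exact: fx|have [_ h] := gP (f z); rewrite (h z)].
Qed.

Lemma mem_irrefl x : ~ x ∈ x.
Proof. by elim/(well_founded_ind (foundation (u := V))): x => x IH xx; exact: (IH x). Qed.

Lemma mem_minimal A : A !=set0 -> exists2 a, A a & forall b, b ∈ a -> ~ A b.
Proof.
move=> [x]; elim/(well_founded_ind (foundation (u := V))): x => x IH Ax.
have [[y yx Ay]|n] := pselect (exists2 y, y ∈ x & A y); first exact: IH yx Ay.
by exists x => // b bx Ab; apply: n; exists b.
Qed.

(** * Ordinals and initial ordinals *)

Lemma ord_mem a b : is_ordinal a -> b ∈ a -> is_ordinal b.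
Proof.
by move=> [ta h] ba; split=> [|c cb]; [exact: h|apply: h; exact: ta cb].
Qed.

Lemma ord_trans a b c : is_ordinal a -> b ∈ a -> c ∈ b -> c ∈ a.
Proof. by move=> [ta _] ba cb; exact: ta cb. Qed.

Lemma ord_total a b : is_ordinal a -> is_ordinal b -> [\/ a ∈ b, a = b | b ∈ a].
Proof.
elim/(well_founded_ind (foundation (u := V))): a b => a IHa b.
elim/(well_founded_ind (foundation (u := V))): b => b IHb oa ob.
have [|/existsNP[c /not_implyP[ca ncb]]] := pselect (a ⊆ b); last first.
  by have [//|e|bc] := IHa c ca b (ord_mem oa ca) ob; constructor 3;
    [rewrite -e|exact: ord_trans bc].
have [|/existsNP[c /not_implyP[cb nca]] _] := pselect (b ⊆ a).
  by move=> ba ab; constructor 2; exact: subset_anti.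
by have [ac|->|//] := IHb c cb oa (ord_mem ob cb); constructor 1; [exact: ord_trans ac|].
Qed.

Lemma ord_leVlt a b : is_ordinal a -> is_ordinal b -> a ⊆ b \/ b ∈ a.
Proof.
move=> oa ob; have [ab|->|] := ord_total oa ob; [left|by left|by right].
by case: ob => tb _; exact: tb.
Qed.

Lemma ord_lt_nle a b : b ∈ a -> ~ a ⊆ b.
Proof. by move=> ba /(_ b ba) /mem_irrefl. Qed.

Lemma ord_le_lt_trans a b c : is_ordinal a -> is_ordinal c -> a ⊆ b -> b ∈ c -> a ∈ c.
Proof.
move=> oa oc ab bc; have ob := ord_mem oc bc.
have [ab'|->//|/ord_lt_nle//] := ord_total oa ob; exact: ord_trans ab'.
Qed.

Lemma ord_mem_sub a b : is_ordinal a -> b ∈ a -> b ⊆ a.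
Proof. by case=> ta _; exact: ta. Qed.

Definition succ a : V := of_set (elts a `|` [set a]).

Lemma elts_succ a : elts (succ a) = elts a `|` [set a].
Proof.
apply: of_setE; have [p pP] := pairing a a; have [q qP] := pairing a p.
have [u uP] := Defs.union q; exists u; apply/seteqP.
(split=> z; rewrite /elts /= uP) => [[y]|[za|->]].
- by move/qP => [->|->]; [left|move/pP => [->|->]; right].
- by exists a => //; apply/qP; left.
- by exists p; [apply/qP; right|apply/pP; left].
Qed.

Lemma mem_succ a b : b ∈ succ a <-> b ∈ a \/ b = a.
Proof. by rewrite -[b ∈ _]/(elts (succ a) b) elts_succ. Qed.

Lemma ord_succ a : is_ordinal a -> is_ordinal (succ a).
Proof.
move=> oa; split=> [b /mem_succ[ba|->] c cb|b /mem_succ[ba|->]].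
- by apply/mem_succ; left; exact: ord_trans cb.
- by apply/mem_succ; left.
- by have [] := ord_mem oa ba.
- by case: oa.
Qed.

Lemma ord_union x : (forall a, a ∈ x -> is_ordinal a) ->
  exists2 u, is_ordinal u & elts u = \bigcup_(a in elts x) elts a.
Proof.
move=> ox; have [u uP] := Defs.union x.
exists u; last by apply/seteqP; (split=> z; rewrite /elts /= uP) => -[y ? ?]; exists y.
split=> b /uP[y yx byy].
  by move=> c cb; apply/uP; exists y => //; exact: ord_trans (ox _ yx) byy cb.
by have [] := ord_mem (ox _ yx) byy.
Qed.

Lemma cardinal_lt_card k a : is_cardinal k -> a ∈ k -> ~ (elts k #<= elts a).
Proof. by move=> [_ h] /h[]. Qed.

Lemma ord_small_mem k a : is_ordinal k -> is_ordinal a ->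
  ~ (elts k #<= elts a) -> a ∈ k.
Proof.
move=> ok oa n; have [ka|//] := ord_leVlt ok oa.
by case: n; exact: subset_card_le.
Qed.

Lemma card_ltP A B : card_lt A B <-> ~ (B #<= A).
Proof. by split=> [[]//|n]; split=> //; case: (card_le_total A B). Qed.

Lemma card_lt_le A B A' : A `<=` B -> card_lt B A' -> card_lt A A'.
Proof.
move=> AB /card_ltP n; apply/card_ltP => h; apply: n.
exact: card_le_trans h (subset_card_le AB).
Qed.

(** Adjoining one point to [b] does not bring its size up to [k]: the result is still finite, or it
    has the size of [b]. *)
Lemma infinite_succ_mem k b : is_cardinal k -> infinite_set (elts k) -> b ∈ k ->
  succ b ∈ k.
Proof.
move=> ck ik bk; have [ok _] := ck.
have ob := ord_mem ok bk.
apply: ord_small_mem => //; first exact: ord_succ.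
rewrite elts_succ => h; have [fb|ib] := pselect (finite_set (elts b)).
  by apply: ik; apply: (card_le_finite h); rewrite finite_setU; split.
apply: (cardinal_lt_card ck bk); apply: card_le_trans h _.
apply: card_setU_le => //.
exact: card_le_trans (countable1 b) ((infiniteP _).1 ib).
Qed.

(** ** Cofinality *)

Lemma not_cofinal_bounded a X : is_ordinal a -> X `<=` elts a ->
  ~ cofinal (elts a) (@subset_of V) X -> exists2 p, p ∈ a & X `<=` elts p.
Proof.
move=> oa Xa /not_andP[//|/existsNP[p /not_implyP[pa np]]].
exists p => // q Xq; have [pq|//] := ord_leVlt (ord_mem oa pa) (ord_mem oa (Xa _ Xq)).
by case: np; exists q.
Qed.

(** Here and below, small means [~ (elts k #<= X)], which [card_ltP] identifies with [card_lt] and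
    which also applies to index sets outside [V]. *)
Lemma cf_ge_bounded a k X : is_ordinal a -> cf_ge a k -> X `<=` elts a ->
  ~ (elts k #<= X) -> exists2 p, p ∈ a & X `<=` elts p.
Proof.
move=> oa [c [_ _ cX] kc] Xa nX; apply: not_cofinal_bounded => // /cX h.
by apply: nX; apply: card_le_trans h; exact: subset_card_le.
Qed.

Lemma regular_ord k : is_regular k -> is_ordinal k.
Proof. by case=> -[]. Qed.

Lemma regular_bounded k X : is_regular k -> X `<=` elts k ->
  ~ (elts k #<= X) -> exists2 p, p ∈ k & X `<=` elts p.
Proof.
move=> rk; apply: cf_ge_bounded; first exact: regular_ord.
by case: rk => _ _ h; exists k.
Qed.

(** Let [g] inject [k] into the union. The arguments sent into one [F i] are bounded by some [p i],
    and all the [p i] lie below one [q]; but [g q] is in some [F i], whence [q ∈ p i ∈ q]. *)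
Lemma regular_bigcup k (I : Type) (D : set I) (F : I -> set V) : is_regular k ->
  ~ (elts k #<= D) -> (forall i, D i -> ~ (elts k #<= F i)) ->
  ~ (elts k #<= \bigcup_(i in D) F i).
Proof.
move=> rk nD nF h; have [g [gF gI]] := card_leE k h.
have /choice[p pP] : forall i, exists p, D i -> p ∈ k /\ forall q, q ∈ k -> F i (g q) -> q ∈ p.
  move=> i; have [Di|nDi] := pselect (D i); last by exists k.
  have [||p pk Xp] := @regular_bounded k [set q | q ∈ k /\ F i (g q)] rk.
  - by move=> q [].
  - move=> h'; apply: (nF _ Di); apply: card_le_trans h' _.
    by apply: (set_inj_card_le (f := g)) => [q []//|q q' [? _] [? _]]; exact: gI.
  by exists p => _; split=> // q qk Fq; exact: Xp.
have [||q qk Xq] := @regular_bounded k (p @` D) rk.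
- by move=> _ [i Di <-]; case: (pP i Di).
- by move=> h'; apply: nD; exact: card_le_trans h' (card_image_le _ _).
have [i Di Fi] := gF _ qk.
have qp : q ∈ p i by case: (pP i Di) => _; apply.
apply: (@mem_irrefl q); apply: (ord_trans (ord_mem (regular_ord rk) qk) _ qp).
by apply: Xq; exists i.
Qed.

Lemma regular_not_finite k (T : Type) (A : set T) : is_regular k -> finite_set A ->
  ~ (elts k #<= A).
Proof. by move=> [_ ik _] fA h; apply: ik; exact: card_le_finite h fA. Qed.

Lemma regular_setU k A B : is_regular k -> ~ (elts k #<= A) -> ~ (elts k #<= B) ->
  ~ (elts k #<= A `|` B).
Proof.
move=> rk nA nB; have -> : A `|` B = \bigcup_(b in [set: bool]) (if b then A else B).
  apply/seteqP; split=> [x [Ax|Bx]|x [[] _ ?]];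
    by [exists true|exists false|left|right].
apply: (@regular_bigcup k _ [set: bool] _ rk) => [|[]//].
by apply: (regular_not_finite rk); exact: finite_finset.
Qed.

(** Induction on the size, setting aside the element numbered last. It serves to show that infinite
    cardinals have infinite cofinality. *)
Lemma finite_bounded k X : is_ordinal k -> (forall b, b ∈ k -> succ b ∈ k) ->
  elts k !=set0 -> X `<=` elts k -> finite_set X -> exists2 p, p ∈ k & X `<=` elts p.
Proof.
move=> ok lim [k0 k0k] Xk /finite_set_leP[n /(card_leE 0)[f [fn fI]]].
elim: n X Xk fn fI => [|n IH] X Xk fn fI.
  by exists k0 => // x /fn.
have [||x y [Xx _] [Xy _]|p pk Xp] := IH (X `&` [set x | (f x < n)%N]).
- by move=> x [/Xk].
- by move=> x [].
- exact: fI.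
have [[x Xx fx]|nx] := pselect (exists2 x, X x & f x = n); last first.
  exists p => // x Xx; apply: Xp; split=> //=; have := fn _ Xx => /=.
  by rewrite ltnS leq_eqVlt => /orP[/eqP fx|//]; case: nx; exists x.
have sub q : p ⊆ q -> x ∈ q -> X `<=` elts q.
  move=> pq xq y Xy; have := fn _ Xy => /=; rewrite ltnS leq_eqVlt => /orP[/eqP fy|fy].
    by rewrite -(fI x y) // fy.
  by apply: pq; apply: Xp.
have xk := Xk _ Xx.
have [h|h] := ord_leVlt (ord_mem ok pk) (ord_succ (ord_mem ok xk)).
  by exists (succ x); [exact: lim|apply: sub => //; apply/mem_succ; right].
exists p => //; apply: sub => //.
by apply: (ord_trans (ord_mem ok pk) h); apply/mem_succ; right.
Qed.

Lemma cf_infinite k c : is_cardinal k -> infinite_set (elts k) -> is_cf k c ->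
  infinite_set (elts c).
Proof.
move=> ck ik [_ [X [Xk Xcof] Xc] _] fc; have [ok _] := ck.
have [k0 k0k] := infinite_setN0 ik.
have [|||p pk Xp] := @finite_bounded k X ok _ _ Xk.
- by move=> b; exact: infinite_succ_mem.
- by exists k0.
- by move/card_eqPle: Xc => [h _]; exact: card_le_finite h fc.
have [q /Xp qp /(ord_lt_nle)] := Xcof _ pk; exact.
Qed.

(** ** Sets of hereditarily small cardinality *)

Lemma trclE z : trcl z = \bigcup_(y in elts z) ([set y] `|` trcl y).
Proof.
apply/seteqP; split=> [w|w [y yz [->|wy]]]; last 2 first.
- by rewrite /trcl /=; apply: t_step.
- by rewrite /trcl /=; apply: (@t_trans V _ w y z wy); exact: t_step.
rewrite {1}/trcl /=; elim=> {w z} [x y xy|x y z xy _ yz [u uz [e|yu]]].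
- by exists x => //; left.
- by exists u => //; right; rewrite -e.
- by exists u => //; right; exact: t_trans yu.
Qed.

(** The transitive closure of [z] is a union of fewer than [chi] sets of size less than [chi]. *)
Lemma H_small chi z : is_regular chi -> elts z `<=` H_ chi -> ~ (elts chi #<= elts z) ->
  H_ chi z.
Proof.
move=> rc zH nz; apply/card_ltP; rewrite trclE; apply: (regular_bigcup rc) => // y /zH/card_ltP Hy.
apply: (regular_setU rc) => //; apply: (regular_not_finite rc); exact: finite_set1.
Qed.

(** The transitive closure of an ordinal is contained in that ordinal. *)
Lemma H_ord chi a : is_cardinal chi -> a ∈ chi -> H_ chi a.
Proof.
move=> cc ac; apply: card_lt_le (proj2 cc a ac) => z; rewrite /trcl /=.
have := ord_mem (proj1 cc) ac => oa za.
move: oa; elim: za => {z ac} [x y //|x y z _ IHx _ IHy oz].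
by apply: (ord_trans oz (IHy oz)); apply: IHx; exact: ord_mem oz (IHy oz).
Qed.
End SetTheory.

(** * Closures and elementary submodels *)

Section Closure.
Variables (T : Type) (op : nat -> seq T -> T) (x : T).
Implicit Types (A B : set T) (s : seq T).

(* [nth x s] reads a finite sequence of arguments as an infinite one that is
   eventually [x]: operations then have no arity. *)
Inductive clo A : T -> Prop :=
| clo_base a : A a -> clo A a
| clo_default : clo A x
| clo_op n s : (forall i, clo A (nth x s i)) -> clo A (op n s).

(** Only the finitely many entries of [s] matter: beyond its end the value is [x], which lies in
    every [Q i]. *)
Lemma directed_seq I (D : set I) (Q : I -> set T) :
  D !=set0 -> (forall i, D i -> Q i x) ->
  (forall i j, D i -> D j -> exists2 k, D k & Q i `<=` Q k /\ Q j `<=` Q k) ->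
  forall s, (forall n, exists2 i, D i & Q i (nth x s n)) ->
  exists2 i, D i & forall n, Q i (nth x s n).
Proof.
move=> [i0 Di0] Qx dir; elim=> [|a s IH] h.
  by exists i0 => // n; rewrite nth_nil; exact: Qx.
have [i Di Qi] := IH (fun n => h n.+1); have [j Dj Qj] := h 0.
have [k Dk [ik jk]] := dir _ _ Di Dj.
by exists k => // -[|n]; [exact: jk|exact: ik (Qi n)].
Qed.

Lemma card_args U A (K : set U) : infinite_set K -> A #<= K ->
  [set s | forall i, A (nth x s i)] #<= K.
Proof.
move=> iK AK.
have natK : [set: nat] #<= K by apply/infiniteP.
pose L n := [set s | size s = n /\ forall i, A (nth x s i)].
apply: (@card_le_trans _ _ _ (\bigcup_(n in [set: nat]) L n)).
  by apply: subset_card_le => s As; exists (size s).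
apply: card_bigcup_le => //; first exact: card_squared.
elim=> [_|n IH _].
  apply: card_le_trans natK; apply: (set_inj_card_le (f := size)) => //.
  by move=> s t [/size0nil-> _] [/size0nil-> _].
apply: (@card_le_trans _ _ _ (\bigcup_(a in A) (cons a @` L n))).
  apply: subset_card_le => -[|a s] [//= [sn] As]; exists a; first exact: (As 0).
  by exists s => //; split=> // i; exact: (As i.+1).
apply: card_bigcup_le => // [|a _]; first exact: card_squared.
exact: card_le_trans (card_image_le _ _) (IH I).
Qed.

(** The closure is the union of countably many stages [S n], each adding the values of the
    operations on the stage before. *)
Lemma card_clo U A (K : set U) : infinite_set K -> A #<= K -> clo A #<= K.
Proof.
move=> iK AK; have KK := card_squared iK.
have natK : [set: nat] #<= K by apply/infiniteP.
pose step B := B `|` \bigcup_(n in [set: nat])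
  (op n @` [set s | forall i, B (nth x s i)]).
pose S := fix S n := if n is n'.+1 then step (S n') else A `|` [set x].
have SS n m : S n `<=` S (m + n)%N by elim: m => // m IH a /IH; left.
have SK n : S n #<= K.
  elim: n => [|n IH] /=.
    by apply: card_setU_le => //; exact: card_le_trans (countable1 x) natK.
  apply: card_setU_le => //; apply: card_bigcup_le => // m _.
  exact: card_le_trans (card_image_le _ _) (card_args iK IH).
apply: (@card_le_trans _ _ _ (\bigcup_(n in [set: nat]) S n)); last exact: card_bigcup_le.
apply: subset_card_le => a; elim=> [{}a Aa||n s _ IH].
- by exists 0 => //; left.
- by exists 0 => //; right.
have [||||n' _ Sn'] := @directed_seq nat [set: nat] S _ _ _ s.
- by exists 0.
- by move=> i _; rewrite -(addn0 i); apply: SS; right.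
- move=> i j _ _; exists (i + j)%N => //; split; last exact: SS.
  by rewrite addnC; exact: SS.
- by move=> i; have [m _ Sm] := IH i; exists m.
by exists n'.+1 => //; right; exists n => //; exists s.
Qed.
End Closure.

(** * Formulas, Skolem functions and the Tarski-Vaught test *)

Section Formulas.

Fixpoint code (f : formula) : GenTree.tree nat :=
  match f with
  | FEq i j => GenTree.Node 0 [:: GenTree.Leaf i; GenTree.Leaf j]
  | FMem i j => GenTree.Node 1 [:: GenTree.Leaf i; GenTree.Leaf j]
  | FFalse => GenTree.Node 2 [::]
  | FImp f g => GenTree.Node 3 [:: code f; code g]
  | FAll f => GenTree.Node 4 [:: code f]
  end.

Lemma code_inj : injective code.
Proof.
elim=> [i j|i j||f IHf g IHg|f IHf] [i' j'|i' j'||f' g'|f'] //=.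
- by case=> -> ->.
- by case=> -> ->.
- by case=> /IHf -> /IHg ->.
- by case=> /IHf ->.
Qed.

Definition nth_formula (n : nat) : formula :=
  if pselect (exists f, pickle (code f) = n) is left h then projT1 (cid h) else FFalse.

Lemma nth_formula_surj f : exists n, nth_formula n = f.
Proof.
exists (pickle (code f)); rewrite /nth_formula; case: pselect => [h|[]]; last by exists f.
by case: cid => g /= /(pcan_inj pickleK) /code_inj.
Qed.

(** Truth depends only on the variables below this bound, so finite sequences of parameters suffice
    for Skolem functions. *)
Fixpoint var_bound (f : formula) : nat :=
  match f with
  | FEq i j | FMem i j => (maxn i j).+1
  | FFalse => 0
  | FImp f g => maxn (var_bound f) (var_bound g)
  | FAll f => (var_bound f).-1
  end.

Lemma eq_sat (V : universe) (D : set V) f (e e' : nat -> V) :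
  (forall i, (i < var_bound f)%N -> e i = e' i) -> sat D e f <-> sat D e' f.
Proof.
elim: f e e' => [i j|i j||f IHf g IHg|f IH] e e' /= ee //.
- by rewrite !ee // ltnS ?leq_maxl ?leq_maxr.
- by rewrite !ee // ltnS ?leq_maxl ?leq_maxr.
- have hf := IHf e e' (fun i h => ee i (leq_trans h (leq_maxl _ _))).
  have hg := IHg e e' (fun i h => ee i (leq_trans h (leq_maxr _ _))).
  tauto.
- have h x : sat D (env_cons x e) f <-> sat D (env_cons x e') f.
    by apply: IH => -[|i] //= h; apply: ee; case: (var_bound f) h.
  by split=> hs x Dx; apply/h; exact: hs.
Qed.

(** Chooses a counterexample instead of a witness, because the primitive quantifier is the universal
    one. *)
Definition skolem (V : universe) (H : set V) (x : V) (f : formula) (s : seq V) : V :=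
  if pselect (exists y, H y /\ ~ sat H (env_cons y (nth x s)) f) is left h
  then projT1 (cid h) else x.

Lemma skolem_in (V : universe) (H : set V) x f s : H x -> H (skolem H x f s).
Proof. by rewrite /skolem; case: pselect => // h; case: cid => y []. Qed.

(** In the quantifier case, a counterexample in [H] could be replaced by the one that [skolem]
    picks, which lies in [M]. *)
Lemma tarski_vaught (V : universe) (H M : set V) x :
  M x -> M `<=` H ->
  (forall f s, (forall i, M (nth x s i)) -> M (skolem H x f s)) ->
  elementary_submodel M H.
Proof.
move=> Mx MH Msk; split=> //; first by exists x.
elim=> [i j|i j||f IHf g IHg|f IH] e Me //=.
  by have := IHf e Me; have := IHg e Me; tauto.
have Mcons y : M y -> forall i, M (env_cons y e i) by move=> My [].
split=> h y; last by move=> My; apply/(IH _ (Mcons _ My)); apply: h; exact: MH.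
move=> Hy; apply: contrapT => ny.
pose s := mkseq e (var_bound f).
have es z : sat H (env_cons z (nth x s)) f <-> sat H (env_cons z e) f.
  apply: eq_sat => -[|i] //= h'; rewrite nth_mkseq //; exact: ltnW.
have Ms i : M (nth x s i).
  have [h'|h'] := ltnP i (var_bound f); first by rewrite nth_mkseq.
  by rewrite nth_default // size_mkseq.
have := Msk f s Ms; rewrite /skolem.
case: pselect => [h'|[]]; last by exists y; split=> // /es.
case: cid => z /= [Hz nz] Mz; apply: nz; apply/es.
by apply/(IH _ (Mcons _ Mz)); exact: h.
Qed.
End Formulas.

(** * Hulls under enumerations, covers and Skolem functions *)

Section Hull.
Variables (V : universe) (H : set V) (x : V).
Variables (en : V -> V -> V) (P : V -> V -> V -> set V).
Implicit Types (G : V -> V -> V -> V -> V) (xi eta l i g z : V) (A B : set V).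

(** Values outside [H] are replaced by [x], which keeps hulls inside [H]. *)
Let inH y := if pselect (H y) then y else x.

Let inHE y : H y -> inH y = y. Proof. by rewrite /inH; case: pselect. Qed.

Let inHx : inH x = x. Proof. by rewrite /inH; case: pselect. Qed.

Definition hull_op G (n : nat) (s : seq V) : V :=
  match n with
  | 0 => inH (en (nth x s 0) (nth x s 1))
  | 1 => inH (G (nth x s 0) (nth x s 1) (nth x s 2) (nth x s 3))
  | n'.+2 => skolem H x (nth_formula n') s
  end.

(* [cover xi l i g] is the hull of [P l i g] under operations that include
   [cover eta] for [eta] below [xi]. *)
Definition cover : V -> V -> V -> V -> V :=
  Fix (foundation (u := V)) (fun=> V -> V -> V -> V)
    (fun xi rec l i g => of_set (clo (hull_op (fun eta l i g =>
        if pselect (eta ∈ xi) is left h then rec eta h l i g else x)) x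
      (P l i g `|` elts xi))).

Definition cover_below xi eta l i g : V :=
  if pselect (eta ∈ xi) then cover eta l i g else x.

(** The ordinals below [xi] count as generators, so that every [cover eta] with [eta ∈ xi] can be
    applied inside the hull. *)
Definition hull xi A : set V := clo (hull_op (cover_below xi)) x (A `|` elts xi).

Let cover_belowE xi eta : eta ∈ xi -> cover_below xi eta = cover eta.
Proof.
move=> h; apply/funext => l; apply/funext => i; apply/funext => g.
by rewrite /cover_below; case: pselect.
Qed.

Let cover_below_out xi eta l i g : ~ eta ∈ xi -> cover_below xi eta l i g = x.
Proof. by rewrite /cover_below; case: pselect. Qed.

Lemma coverE xi l i g : cover xi l i g = of_set (hull xi (P l i g)).
Proof.
rewrite /cover Fix_eq; last first.
  move=> y F F' FF'; suff -> : F = F' by [].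
  apply: functional_extensionality_dep => eta; exact: functional_extensionality_dep.
rewrite /hull; congr (of_set (clo (hull_op _) _ _)).
by apply/funext => eta; apply/funext=> l'; apply/funext=> i'; apply/funext=> g'; rewrite /cover_below; case: pselect.
Qed.

Lemma sub_hull xi A : A `<=` hull xi A.
Proof. by move=> a Aa; apply: clo_base; left. Qed.

Lemma hull_default xi A : hull xi A x.
Proof. exact: clo_default. Qed.

Lemma index_sub_hull xi A : elts xi `<=` hull xi A.
Proof. by move=> a Aa; apply: clo_base; right. Qed.

Lemma hull_en xi A z i : hull xi A z -> hull xi A i -> H (en z i) -> hull xi A (en z i).
Proof.
move=> hz hi He; have := @clo_op _ (hull_op (cover_below xi)) x
  (A `|` elts xi) 0 [:: z; i].
rewrite /= inHE //; apply=> -[|[|n]] //=.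
by rewrite nth_nil; exact: hull_default.
Qed.

Lemma hull_cover xi A eta l i g : eta ∈ xi -> hull xi A l -> hull xi A i ->
  hull xi A g -> H (cover eta l i g) -> hull xi A (cover eta l i g).
Proof.
move=> hx hl hi hg He; have := @clo_op _ (hull_op (cover_below xi)) x
  (A `|` elts xi) 1 [:: eta; l; i; g].
rewrite /= cover_belowE // inHE //.
apply=> -[|[|[|[|n]]]] //=; first exact: index_sub_hull.
by rewrite nth_nil; exact: hull_default.
Qed.

Lemma hull_sub xi A : H x -> A `<=` H -> elts xi `<=` H -> hull xi A `<=` H.
Proof.
move=> Hx AH xH a; rewrite {1}/hull; elim=> [{}a [/AH|/xH]//|//|[|[|n]] s _ _ /=].
- by rewrite /inH; case: pselect.
- by rewrite /inH; case: pselect.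
- exact: skolem_in.
Qed.

Lemma hull_elementary xi A : H x -> A `<=` H -> elts xi `<=` H ->
  elementary_submodel (hull xi A) H.
Proof.
move=> Hx AH xH; apply: (@tarski_vaught _ _ _ x); [exact: clo_default|exact: hull_sub|].
by move=> f s hs; have [n <-] := nth_formula_surj f; exact: (@clo_op _ _ _ _ n.+2).
Qed.

Lemma card_hull (U : Type) (K : set U) xi A : infinite_set K -> A #<= K -> elts xi #<= K ->
  hull xi A #<= K.
Proof. by move=> iK AK xK; apply: card_clo => //; exact: card_setU_le. Qed.

(** The two levels differ only in the covering operation, and there the lower one agrees with the
    higher or returns [x], a member of every hull. *)
Lemma hull_mono xi xi' A B : xi ⊆ xi' -> A `<=` hull xi' B -> hull xi A `<=` hull xi' B.
Proof.
move=> xx AB a; rewrite {1}/hull; elim=> [{}a [/AB//|/xx]||n s _ IH]; [exact: index_sub_hull|exact: hull_default|].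
have := clo_op n IH; case: n => [|[|n]] //=.
have [h|nh _] := pselect (nth x s 0 ∈ xi); last first.
  by rewrite cover_below_out // inHx; exact: hull_default.
by rewrite !cover_belowE //; exact: xx.
Qed.

Lemma hull_le_sub xi A B : A `<=` B -> hull xi A `<=` hull xi B.
Proof. by move=> AB; apply: hull_mono => // a /AB; exact: sub_hull. Qed.

(** An operation has finitely many relevant arguments, and these lie in the hull of a single piece
    of the directed union. *)
Lemma hull_bigcup I (D : set I) (F : I -> set V) xi : D !=set0 ->
  (forall u v, D u -> D v -> exists2 w, D w & F u `<=` F w /\ F v `<=` F w) ->
  hull xi (\bigcup_(u in D) F u) `<=` \bigcup_(u in D) hull xi (F u).
Proof.
move=> [u0 Du0] dir a; rewrite {1}/hull; elim=> [{}a [[u Du Fa]|xa]||n s _ IH].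
- by exists u => //; exact: sub_hull.
- by exists u0 => //; exact: index_sub_hull.
- by exists u0 => //; exact: hull_default.
have [||||u Du hu] := @directed_seq _ x _ D (fun u => hull xi (F u)) _ _ _ s.
- by exists u0.
- by move=> u _; exact: hull_default.
- move=> u v Du Dv; have [w Dw [uw vw]] := dir _ _ Du Dv.
  by exists w => //; split; exact: hull_le_sub.
- by move=> m; have [u Du hu] := IH m; exists u.
by exists u => //; exact: clo_op.
Qed.

Lemma hull_finite xi A a : hull xi A a ->
  exists F, [/\ F `<=` A, finite_set F & hull xi F a].
Proof.
have -> : A = \bigcup_(F in [set F | F `<=` A /\ finite_set F]) F.
  apply/seteqP; split=> [b Ab|b [F [FA _] /FA//]].
  by exists [set b] => //; split; [move=> _ ->|exact: finite_set1].
move=> h; have [||F [FA fF] hF] := hull_bigcup _ _ h.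
- by exists set0; split.
- move=> F F' [FA fF] [FA' fF']; exists (F `|` F').
    by split; [move=> ? [/FA|/FA']|rewrite finite_setU].
  by split=> ?; [left|right].
- by exists F; split=> // b Fb; exists F.
Qed.

(** The finitely many arguments of an operation appear at one level. For a covering operation of
    index in [k], the level must also be raised above that index. *)
Lemma hull_limit k A a : is_ordinal k -> elts k !=set0 ->
  (forall b, b ∈ k -> succ b ∈ k) -> hull k A a ->
  exists2 xi, xi ∈ k & hull xi A a.
Proof.
move=> ok [k0 k0k] lim; rewrite {1}/hull; elim=> [{}a [Aa|ak]||n s _ IH].
- by exists k0 => //; exact: sub_hull.
- by exists (succ a); [exact: lim|apply: index_sub_hull; apply/mem_succ; right].
- by exists k0 => //; exact: hull_default.
have [||||xi xik hxi] := @directed_seq _ x _ (elts k) (fun xi => hull xi A) _ _ _ s.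
- by exists k0.
- by move=> xi _; exact: hull_default.
- move=> i j ik jk; have hm xi xi' : xi ⊆ xi' -> hull xi A `<=` hull xi' A.
    by move=> h; apply: hull_mono => //; exact: sub_hull.
  have [ij|ji] := ord_leVlt (ord_mem ok ik) (ord_mem ok jk).
    by exists j => //; split=> //; exact: hm.
  by exists i => //; split=> //; apply: hm; apply: ord_mem_sub => //; exact: ord_mem ok ik.
- by move=> m; have [i Di hi] := IH m; exists i.
have up xi' : xi' ∈ k -> xi ⊆ xi' ->
    (nth x s 0 ∈ k -> nth x s 0 ∈ xi') -> exists2 xi, xi ∈ k & hull xi A
    (hull_op (cover_below k) n s).
  move=> xk' xx hx; exists xi' => //.
  have hs m : hull xi' A (nth x s m) by apply: hull_mono (hxi m) => //; exact: sub_hull.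
  have := clo_op n hs; case: n => [|[|n]] //=.
  have [h|h] := pselect (nth x s 0 ∈ k); first by rewrite !cover_belowE //; exact: hx.
  by rewrite !cover_below_out // => /(ord_mem_sub ok xk').
have [eta_k|neta] := pselect (nth x s 0 ∈ k); last by apply: (up xi).
have sk := lim _ eta_k; have os := ord_mem ok sk; have oxi := ord_mem ok xik.
have [h|h] := ord_leVlt oxi os.
  by apply: (up (succ (nth x s 0))) => // _; apply/mem_succ; right.
apply: (up xi) => // _; apply: (ord_trans oxi h); apply/mem_succ; right.
by [].
Qed.

(** Each element of [B] needs one level below [k] and finitely many elements of [A]; regularity
    bounds the levels and keeps the union of the finite sets small. *)
Lemma small_sub_hull k A B : is_regular k -> ~ (elts k #<= [set: nat]) ->
  B `<=` hull k A -> ~ (elts k #<= B) ->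
  exists xi C, [/\ xi ∈ k, C `<=` A, ~ (elts k #<= C) & B `<=` hull xi C].
Proof.
move=> rk unk Bh nB; have [ck ik _] := rk; have ok := regular_ord rk.
have /choice[p pP] : forall b, exists p : V * set V, B b ->
    [/\ p.1 ∈ k, p.2 `<=` A, finite_set p.2 & hull p.1 p.2 b].
  move=> b; have [Bb|nb] := pselect (B b); last by exists (b, set0).
  have [xi xik /hull_finite[F [FA fF hF]]] := hull_limit ok (infinite_setN0 ik)
    (fun b => infinite_succ_mem ck ik) (Bh _ Bb).
  by exists (xi, F).
have [||xi xik Xxi] := @regular_bounded _ k [set (p b).1 | b in B] rk.
- by move=> _ [b Bb <-]; case: (pP b Bb).
- by move=> h; apply: nB; exact: card_le_trans h (card_image_le _ _).
exists xi, (\bigcup_(b in B) (p b).2); split=> //.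
- by move=> a [b Bb pa]; case: (pP b Bb) => _ h _ _; exact: h.
- apply: (regular_bigcup rk) => // b Bb; have [_ _ fb _] := pP b Bb.
  exact: regular_not_finite.
- move=> b Bb; have [_ _ _ hb] := pP b Bb; apply: hull_mono hb.
    apply: ord_mem_sub; first exact: ord_mem ok xik.
    by apply: Xxi; exists b.
  by move=> c pc; apply: sub_hull; exists b.
Qed.
End Hull.

(** * Successor cardinals and continuous sequences *)

Section Sequences.
Variable V : universe.
Implicit Types (a b c d k p q u y z : V) (A B D S X : set V).

Lemma ord_max2 k a b : is_ordinal k -> a ∈ k -> b ∈ k ->
  exists c, [/\ c ∈ k, a ⊆ c & b ⊆ c].
Proof.
move=> ok ak bk; have [ab|ba] := ord_leVlt (ord_mem ok ak) (ord_mem ok bk).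
  by exists b; split.
by exists a; split=> //; apply: ord_mem_sub => //; exact: ord_mem ok ak.
Qed.

Lemma ord_leE a b : is_ordinal a -> is_ordinal b -> a ⊆ b -> a ∈ b \/ a = b.
Proof.
by move=> oa ob ab; have [|->|/ord_lt_nle//] := ord_total oa ob; [left|right].
Qed.

(** Passing on the set of earlier values is enough for increasing sequences, whose next value only
    has to exceed them. *)
Lemma mem_recursion (F : V -> set V -> V) : exists f, forall b, f b = F b (f @` elts b).
Proof.
pose G b (rec : forall c, c ∈ b -> V) := F b [set y | exists c (h : c ∈ b), rec c h = y].
exists (Fix (foundation (u := V)) (fun=> V) G) => b; rewrite Fix_eq.
  rewrite /G; congr (F _ _); apply/seteqP.
  by split=> y [c]; [case=> h <-; exists c|move=> h <-; exists c, h].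
move=> a g g' gg'; suff -> : g = g' by [].
apply: functional_extensionality_dep => c; exact: functional_extensionality_dep.
Qed.

(** A left inverse of the injection; the enumerations [en] of the matrix are obtained in this
    way. *)
Lemma card_le_surj A B : A #<= B ->
  exists f : V -> V, forall y, A y -> exists2 i, B i & f i = y.
Proof.
have [->|/set0P[a0 _]] := eqVneq A set0; first by exists id.
move=> /(card_leE a0)[g [gB gI]].
have /choice[f fP] : forall i, exists y, forall y', A y' -> g y' = i -> y = y'.
  move=> i; have [[y Ay <-]|n] := pselect (exists2 y, A y & g y = i).
    by exists y => y' Ay' /gI->.
  by exists i => y Ay e; case: n; exists y.
by exists f => y Ay; exists (g y); [exact: gB|exact: fP].
Qed.

Lemma cofinal_enum A (le : V -> V -> Prop) c : is_cof A le c ->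
  exists f : V -> V, forall p, A p -> exists i, [/\ i ∈ c, A (f i) & le p (f i)].
Proof.
move=> [_ [X [XA Xcof] /card_eqPle[Xc _]] _].
have [f fP] := card_le_surj Xc; exists f => p /Xcof[q Xq pq].
by have [i ic e] := fP _ Xq; exists i; rewrite e; split=> //; exact: XA.
Qed.

(* An increasing sequence of length [cf k], cofinal in [k], through a cofinal
   class [Q] of ordinals. *)
Lemma cofinal_sequence k c (Q : V -> Prop) : is_ordinal k -> is_cf k c ->
  (forall b, b ∈ k -> exists l, [/\ b ⊆ l, l ∈ k & Q l]) ->
  exists f : V -> V,
    [/\ forall b, b ∈ c -> f b ∈ k /\ Q (f b),
        forall b b', b ∈ b' -> b' ∈ c -> f b ∈ f b' &
        forall p, p ∈ k -> exists2 b, b ∈ c & p ⊆ f b].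
Proof.
move=> ok cfk hQ; have [cc _ cmin] := cfk; have oc := proj1 cc.
have [g gP] := cofinal_enum cfk.
(* Besides exceeding the earlier values [S], the value at [b] must reach [g b], where [g] enumerates
   a cofinal subset of [k]; this makes the sequence cofinal. *)
pose good b S l := [/\ l ∈ k, Q l, S `<=` elts l & g b ∈ k -> g b ⊆ l].
have [f fE] := mem_recursion (fun b S =>
  if pselect (exists l, good b S l) is left h then projT1 (cid h) else b).
have fgood b : b ∈ c -> good b (f @` elts b) (f b).
  elim/(well_founded_ind (foundation (u := V))): b => b IH bc.
  rewrite (fE b); case: pselect => [h|[]]; first by case: cid.
  have Sk : f @` elts b `<=` elts k.
    by move=> _ [b' b'b <-]; case: (IH _ b'b (ord_trans oc bc b'b)).
  (* There are fewer than [cf k] earlier values, so they are bounded in [k]. *)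
  have [|p pk Sp] := not_cofinal_bounded ok Sk.
    move=> /cmin h; apply: (cardinal_lt_card cc bc).
    exact: card_le_trans h (card_image_le _ _).
  have [q [qk pq gq]] : exists q, [/\ q ∈ k, p ⊆ q & g b ∈ k -> g b ⊆ q].
    have [gk|ngk] := pselect (g b ∈ k); last by exists p; split.
    by have [q [? ? ?]] := ord_max2 ok pk gk; exists q; split.
  have [l [ql lk Ql]] := hQ _ qk; exists l; split=> //.
    by move=> s /Sp sp; apply: ql; exact: pq.
  by move=> /gq gbq s /gbq; exact: ql.
exists f; split=> [b /fgood[]//|b b' bb' b'c|p /gP[b [bc gk pg]]].
  by have [_ _ h _] := fgood _ b'c; apply: h; exists b.
exists b => //; have [_ _ _ h] := fgood _ bc.
by move=> s /pg; exact: h.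
Qed.

(** * Regularity of the successor cardinal and enumeration of a club *)

Section Successor.
Variables (mu muplus : V).
Hypothesis muplusP : is_successor_cardinal mu muplus.
Hypothesis cmu : is_cardinal mu.
Hypothesis imu : infinite_set (elts mu).

Let omp : is_ordinal muplus. Proof. by case: muplusP => -[]. Qed.
Let mump : mu ∈ muplus. Proof. by case: muplusP. Qed.

(** The least ordinal up to [a] that does not embed in [mu] would be a cardinal strictly between
    [mu] and [muplus]. *)
Lemma card_below_successor a : a ∈ muplus -> elts a #<= elts mu.
Proof.
move=> amp; apply: contrapT => na; have oa := ord_mem omp amp.
have [l [ls nl] lmin] : exists2 l, l ∈ succ a /\ ~ (elts l #<= elts mu) &
    forall b, b ∈ l -> ~ (b ∈ succ a /\ ~ (elts b #<= elts mu)).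
  have [|l ? ?] := @mem_minimal V [set l | l ∈ succ a /\ ~ (elts l #<= elts mu)].
    by exists a; split=> //; apply/mem_succ; right.
  by exists l.
have os := ord_succ oa; have ol := ord_mem os ls.
have cl : is_cardinal l.
  split=> // b bl; apply/card_ltP => lb; apply: nl; apply: card_le_trans lb _.
  by apply: contrapT => nb; apply: (lmin _ bl); split=> //; exact: ord_trans bl.
have mul : mu ∈ l.
  have [lmu|//] := ord_leVlt ol (proj1 cmu); case: nl; exact: subset_card_le.
have lmp : l ∈ muplus.
  by move/mem_succ: ls => [la|->//]; exact: ord_trans amp la.
by have [_ _ /(_ l cl mul l lmp)] := muplusP; exact: mem_irrefl.
Qed.

Lemma infinite_successor : infinite_set (elts muplus).
Proof.
move=> f; apply: imu; apply: sub_finite_set f; exact: ord_mem_sub.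
Qed.

Lemma successor_limit b : b ∈ muplus -> succ b ∈ muplus.
Proof. by apply: infinite_succ_mem; [case: muplusP|exact: infinite_successor]. Qed.

(** The supremum is a union of at most [mu] sets of size at most [mu], hence too small to reach
    [muplus]. *)
Lemma successor_regular a (f : V -> V) : a ∈ muplus ->
  (forall b, b ∈ a -> f b ∈ muplus) ->
  exists2 u, u ∈ muplus & elts u = \bigcup_(b in elts a) elts (f b).
Proof.
move=> amp fmp.
have fa : elts (of_set (f @` elts a)) = f @` elts a.
  by apply: (@of_set_small _ _ a); exact: card_image_le.
have [|u ou uE] := @ord_union V (of_set (f @` elts a)).
  move=> y; rewrite -[y ∈ _]/(elts (of_set (f @` elts a)) y) fa => -[b ba <-].
  exact: ord_mem omp (fmp _ ba).
rewrite fa bigcup_image in uE.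
exists u => //; apply: ord_small_mem => //; rewrite uE => h.
have [cmp _ _] := muplusP; apply: (cardinal_lt_card cmp mump).
apply: card_le_trans h _; apply: card_bigcup_le.
- exact: card_squared.
- exact: card_below_successor.
- by move=> b ba; exact: card_below_successor (fmp _ ba).
Qed.

(* The increasing enumeration of the members of [D] above [mu]. *)
Lemma club_enumeration D : is_club D muplus ->
  exists f : V -> V,
    [/\ forall a, a ∈ muplus -> [/\ f a ∈ muplus, D (f a) & mu ⊆ f a],
        forall a b, b ∈ a -> a ∈ muplus -> f b ∈ f a &
        forall a, a ∈ muplus -> is_limit a ->
          elts (f a) = \bigcup_(b in elts a) elts (f b)].
Proof.
move=> [[Dmp Dcof] Dclosed].
pose above S d := [/\ D d, mu ⊆ d & S `<=` elts d].
have [f fE] := mem_recursion (fun b S =>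
  if pselect (exists2 d, above S d & forall d', d' ∈ d -> ~ above S d') is left h
  then projT1 (cid2 h) else b).
have fP a : a ∈ muplus -> above (f @` elts a) (f a) /\
    forall d', d' ∈ f a -> ~ above (f @` elts a) d'.
  elim/(well_founded_ind (foundation (u := V))): a => a IH amp.
  rewrite (fE a); case: pselect => [h|[]]; first by case: cid2.
  apply: mem_minimal.
  have [|u ump uE] := @successor_regular a (fun b => succ (f b)) amp.
    move=> b ba; apply: successor_limit.
    have [[+ _ _] _] := IH _ ba (ord_trans omp amp ba); exact: Dmp.
  have [v [vmp uv muv]] := ord_max2 omp ump mump.
  have [d Dd vd] := Dcof _ vmp; exists d; split=> //.
    by move=> s /muv; exact: vd.
  move=> _ [b ba <-]; apply: vd; apply: uv; rewrite uE; exists b => //.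
  by apply/mem_succ; right.
have f1 a : a ∈ muplus -> [/\ f a ∈ muplus, D (f a) & mu ⊆ f a].
  by move=> /fP[[Dfa mufa _] _]; split=> //; exact: Dmp.
have f2 a b : b ∈ a -> a ∈ muplus -> f b ∈ f a.
  by move=> ba /fP[[_ _ h] _]; apply: h; exists b.
exists f; split=> // a amp [oa [b0 b0a] lim].
have [b ba|u ump uE] := @successor_regular a f amp.
  by have [] := f1 _ (ord_trans omp amp ba).
have ou := ord_mem omp ump.
have fu b : b ∈ a -> f b ∈ u.
  move=> /lim[c ca bc]; suff : elts u (f b) by [].
  by rewrite uE; exists c => //; apply: f2 bc _; exact: ord_trans amp ca.
have um b : elts u b -> exists2 c, c ∈ a & b ∈ f c by rewrite uE => -[c]; exists c.
(* At a limit [a], the supremum [u] of the earlier values is in [D] by closure, so the least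
   admissible value [f a] cannot exceed it. *)
suff : above (f @` elts a) u.
  move=> abu; rewrite -uE; have [[_ _ fa] nu] := fP _ amp.
  have [/(ord_mem omp) ofa _ _] := f1 _ amp.
  have [fau|/nu//] := ord_leVlt ofa ou.
  apply/seteqP; split=> // y /um[c ca yfc].
  by apply: (ord_trans ofa _ yfc); apply: fa; exists c.
split; last by move=> _ [b ba <-]; exact: fu.
- apply: Dclosed => //.
    split=> //; first by exists (f b0); exact: fu.
    move=> b /um[c ca bc]; exists (f c) => //; exact: fu.
  split=> [y []//|p /um[c ca pc]]; exists (f c).
    by split; [have [] := f1 _ (ord_trans omp amp ca)|exact: fu].
  apply: ord_mem_sub => //; exact: ord_mem ou (fu _ ca).
- have [_ _ mub] := f1 _ (ord_trans omp amp b0a).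
  by move=> s /mub sb; rewrite uE; exists b0.
Qed.
End Successor.

(** The empty set and singletons are too small to be cofinal in [a]. *)
Lemma cf_ge_limit a k : is_regular k -> is_ordinal a -> cf_ge a k -> is_limit a.
Proof.
move=> rk oa ca; split=> //.
- have [||p pa _] := @cf_ge_bounded _ a k set0 oa ca; [by []| |by exists p].
  exact: regular_not_finite rk (finite_set0 _).
move=> b ba; have [||p pa bp] := @cf_ge_bounded _ a k [set b] oa ca.
- by move=> _ ->.
- exact: regular_not_finite rk (finite_set1 _).
- by exists p => //; exact: bp.
Qed.

(** The image of a cofinal subset of [a] is cofinal in [f a]. Conversely, sending each [y] of a
    cofinal subset of [f a] to some [b ∈ a] with [y ∈ f b] gives a cofinal subset of [a] of no
    larger size. *)
Lemma cf_ge_continuous a k (f : V -> V) : is_ordinal a -> is_ordinal (f a) ->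
  (forall b b', b ∈ b' -> b' ∈ succ a -> f b ∈ f b') ->
  elts (f a) = \bigcup_(b in elts a) elts (f b) ->
  cf_ge a k -> cf_ge (f a) k.
Proof.
move=> oa ofa fmono fE [c [cc [X [Xa Xcof] Xc] cmin] kc]; exists c => //.
have mfa b : b ∈ a -> f b ∈ f a by move=> ba; apply: fmono => //; apply/mem_succ; right.
have mono b b' : b' ∈ a -> b ∈ b' -> f b ∈ f b'.
  by move=> b'a bb'; apply: fmono => //; apply/mem_succ; left.
have ofm b : b ∈ a -> is_ordinal (f b) by move=> ba; exact: ord_mem ofa (mfa _ ba).
have um y : elts (f a) y -> exists2 b, b ∈ a & y ∈ f b by rewrite fE => -[b]; exists b.
split=> //.
  exists (f @` X).
    split=> [_ [b /Xa ba <-]|p /um[b ba pb]]; first exact: mfa.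
    have [q Xq bq] := Xcof _ ba; exists (f q); first by exists q.
    have qa := Xa _ Xq; apply: ord_mem_sub; first exact: ofm.
    have [h|<-//] := ord_leE (ord_mem oa ba) (ord_mem oa qa) bq.
    exact: ord_trans (ofm _ qa) (mono _ _ qa h) pb.
  apply: card_eq_trans Xc; apply: inj_card_eq => b b' /set_mem/Xa ba /set_mem/Xa b'a e.
  have [h|//|h] := ord_total (ord_mem oa ba) (ord_mem oa b'a).
    by have := mono _ _ b'a h; rewrite e => /mem_irrefl.
  by have := mono _ _ ba h; rewrite e => /mem_irrefl.
move=> Y [Ya Ycof].
have /choice[m mP] : forall y, exists b, y ∈ f a -> b ∈ a /\ y ∈ f b.
  move=> y; have [/um[b ba yb]|n] := pselect (y ∈ f a); first by exists b.
  by exists y.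
apply: (@card_le_trans _ _ _ (m @` Y)); last exact: card_image_le.
apply: cmin; split=> [_ [y /Ya/mP[h _] <-]//|p pa].
have [y Yy py] := Ycof _ (mfa _ pa); have [mya yf] := mP _ (Ya _ Yy).
exists (m y); first by exists y.
have [//|h] := ord_leVlt (ord_mem oa pa) (ord_mem oa mya).
have := ord_le_lt_trans (ofm _ pa) (ofm _ mya) py yf.
have := mono _ _ pa h => h1 h2; case: (@mem_irrefl V (f p)).
exact: ord_trans (ofm _ pa) h1 h2.
Qed.
End Sequences.

(** * The matrix *)

Section Matrix.
Variables (V : universe) (kappa mu muplus mustar chi x : V).
Hypotheses (rk : is_regular kappa) (cmu : is_cardinal mu) (kmu : kappa ∈ mu)
  (muplusP : is_successor_cardinal mu muplus) (mustarP : is_cf mu mustar)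
  (stark : mustar ∈ kappa) (rchi : is_regular chi) (mpchi : muplus ⊆ chi)
  (Hx : H_ chi x).
Variables (C : V -> V) (D : set V).
Hypothesis CP : forall a, D a -> cf_ge a kappa ->
  cofinal (elts a) (@subset_of V) (elts (C a)) /\
  forall y, subsets_lt (C a) kappa y ->
    exists2 a', a' ∈ a & y ⊆ C a' /\ card_lt (elts (C a')) (elts kappa).
Variables (lam delta : V -> V) (en F : V -> V -> V).
Hypotheses
  (lamP : forall b, b ∈ mustar -> lam b ∈ mu /\ kappa ⊆ lam b)
  (lam_mono : forall b b', b ∈ b' -> b' ∈ mustar -> lam b ∈ lam b')
  (lam_cof : forall p, p ∈ mu -> exists2 b, b ∈ mustar & p ⊆ lam b)
  (F_cof : forall b, b ∈ mustar -> forall p, subsets_lt (lam b) kappa p ->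
    exists i, [/\ i ∈ lam b, subsets_lt (lam b) kappa (F (lam b) i) & p ⊆ F (lam b) i])
  (deltaP : forall a, a ∈ muplus -> [/\ delta a ∈ muplus, D (delta a) & mu ⊆ delta a])
  (delta_mono : forall a b, b ∈ a -> a ∈ muplus -> delta b ∈ delta a)
  (delta_limit : forall a, a ∈ muplus -> is_limit a ->
    elts (delta a) = \bigcup_(b in elts a) elts (delta b))
  (en_kappa : forall z, elts z #<= elts kappa ->
    forall t, t ∈ z -> exists2 i, i ∈ kappa & en z i = t)
  (en_mu : forall z, elts z #<= elts mu ->
    forall t, t ∈ z -> exists2 i, i ∈ mu & en z i = t).
Implicit Types (a b c d i l p q t y z gam : V).

Let ok : is_ordinal kappa. Proof. exact: regular_ord. Qed.
Let ck : is_cardinal kappa. Proof. by case: rk. Qed.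
Let omu : is_ordinal mu. Proof. by case: cmu. Qed.
Let ostar : is_ordinal mustar. Proof. exact: ord_mem ok stark. Qed.
Let cmp : is_cardinal muplus. Proof. by case: muplusP. Qed.
Let omp : is_ordinal muplus. Proof. by case: cmp. Qed.
Let mump : mu ∈ muplus. Proof. by case: muplusP. Qed.
Let cchi : is_cardinal chi. Proof. by case: rchi. Qed.
Let kchi : kappa ∈ chi. Proof. by apply: mpchi; exact: ord_trans omp mump kmu. Qed.

Let ikappa : infinite_set (elts kappa). Proof. by case: rk. Qed.

Let imu : infinite_set (elts mu).
Proof. by move=> f; apply: ikappa; apply: sub_finite_set f; exact: ord_mem_sub. Qed.

Let istar : infinite_set (elts mustar). Proof. exact: cf_infinite mustarP. Qed.

Let star_lt : ~ (elts kappa #<= elts mustar). Proof. exact: cardinal_lt_card. Qed.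

Let uncountable : ~ (elts kappa #<= [set: nat]).
Proof. by move=> h; apply: star_lt; apply: card_le_trans h _; exact/infiniteP. Qed.

Let Hmp y : y ∈ muplus -> H_ chi y.
Proof. by move=> /mpchi; exact: H_ord. Qed.

Let olam b : b ∈ mustar -> is_ordinal (lam b).
Proof. by move=> /lamP[h _]; exact: ord_mem omu h. Qed.

Let odelta a : a ∈ muplus -> is_ordinal (delta a).
Proof. by move=> /deltaP[h _ _]; exact: ord_mem omp h. Qed.

Let lam_delta a b : a ∈ muplus -> b ∈ mustar -> lam b ∈ delta a.
Proof. by move=> /deltaP[_ _ h] /lamP[h' _]; exact: h. Qed.

Let delta_cf_ge a : a ∈ muplus -> cf_ge a kappa -> cf_ge (delta a) kappa.
Proof.
move=> amp ca; have oa := ord_mem omp amp; have la := cf_ge_limit rk oa ca.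
apply: cf_ge_continuous ca => //; first exact: odelta.
  move=> b b' bb' /mem_succ b'a; apply: delta_mono => //.
  by case: b'a => [h|->//]; exact: ord_trans amp h.
exact: delta_limit.
Qed.

(** As [b] varies, these form an increasing decomposition of [delta a] into [mustar] sets of size
    less than [mu]. *)
Let piece a b : set V := [set y | y ∈ delta a /\ exists2 i, i ∈ lam b & en (delta a) i = y].

Let piece_card a b : piece a b #<= elts (lam b).
Proof.
apply: (@card_le_trans _ _ _ (en (delta a) @` elts (lam b))); last exact: card_image_le.
by apply: subset_card_le => y [_ [i ib <-]]; exists i.
Qed.

Let lam_mem i : i ∈ mu -> exists2 b, b ∈ mustar & i ∈ lam b.
Proof.
move=> imu'; have [b bs h] := lam_cof (infinite_succ_mem cmu imu imu').
by exists b => //; apply: h; apply/mem_succ; right.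
Qed.

Let lam_le b b' : b ⊆ b' -> b ∈ mustar -> b' ∈ mustar -> lam b ⊆ lam b'.
Proof.
move=> bb' bs b's; have [h|->//] := ord_leE (ord_mem ostar bs) (ord_mem ostar b's) bb'.
by apply: ord_mem_sub; [exact: olam|exact: lam_mono].
Qed.

Let piece_cov a y : a ∈ muplus -> y ∈ delta a -> exists2 b, b ∈ mustar & piece a b y.
Proof.
move=> amp yd; have [dmp _ _] := deltaP amp.
have [i imu' e] := en_mu (card_below_successor muplusP cmu dmp) yd.
by have [b bs ib] := lam_mem imu'; exists b => //; split=> //; exists i.
Qed.

(* As [mustar < kappa <= cf (delta a)], one of the [mustar] pieces of
   [C (delta a)] is already cofinal in [delta a]. *)
Let small_cofinal a : exists S : set V, a ∈ muplus -> cf_ge a kappa ->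
  [/\ S `<=` elts (C (delta a)), cofinal (elts (delta a)) (@subset_of V) S &
      exists2 b, b ∈ mustar & S #<= elts (lam b)].
Proof.
have [[amp ca]|n] := pselect (a ∈ muplus /\ cf_ge a kappa); last first.
  by exists set0 => amp ca; case: n.
have [_ Dd _] := deltaP amp; have cd := delta_cf_ge amp ca; have od := odelta amp.
have [[Cd Ccof] _] := CP Dd cd.
suff [b bs h] : exists2 b, b ∈ mustar &
    cofinal (elts (delta a)) (@subset_of V) (elts (C (delta a)) `&` piece a b).
  exists (elts (C (delta a)) `&` piece a b) => _ _; split=> //.
  exists b => //; apply: card_le_trans (piece_card a b).
  by apply: subset_card_le => y [].
apply: contrapT => nb.
have /choice[f fP] : forall b, exists p, b ∈ mustar -> p ∈ delta a /\
    elts (C (delta a)) `&` piece a b `<=` elts p.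
  move=> b; have [bs|nbs] := pselect (b ∈ mustar); last by exists b.
  have [||p pd hp] := @not_cofinal_bounded V (delta a) (elts (C (delta a)) `&` piece a b) od.
  - by move=> y [/Cd].
  - by move=> h; apply: nb; exists b.
  - by exists p.
have [||p pd fp] := cf_ge_bounded (X := f @` elts mustar) od cd.
- by move=> _ [b bs <-]; case: (fP b bs).
- by move=> h; apply: star_lt; exact: card_le_trans h (card_image_le _ _).
have [q Cq pq] := Ccof _ pd; have [b bs qb] := piece_cov amp (Cd _ Cq).
have [fd hf] := fP _ bs; have qf : q ∈ f b by apply: hf.
have fq : f b ∈ q by apply: pq; apply: fp; exists b.
exact: (@mem_irrefl V (f b)) (ord_trans (ord_mem od fd) qf fq).
Qed.

Let core a : set V := projT1 (cid (small_cofinal a)).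

Let coreP a : a ∈ muplus -> cf_ge a kappa ->
  [/\ core a `<=` elts (C (delta a)), cofinal (elts (delta a)) (@subset_of V) (core a) &
      exists2 b, b ∈ mustar & core a #<= elts (lam b)].
Proof. by rewrite /core; case: cid. Qed.

(** The successor makes [lam b] itself a generator, available as a parameter of [cover]. In the case
    of large cofinality, [core a] is the same for all [b]. *)
Let generators a b : set V :=
  elts (succ (lam b)) `|` (if pselect (cf_ge a kappa) then core a else piece a b).

Let generators_core a b : cf_ge a kappa ->
  generators a b = elts (succ (lam b)) `|` core a.
Proof. by rewrite /generators; case: pselect. Qed.

Let generators_piece a b : ~ cf_ge a kappa ->
  generators a b = elts (succ (lam b)) `|` piece a b.
Proof. by rewrite /generators; case: pselect. Qed.

(** What covers a small set of generators: [F l i] the part in [lam b], [C gam] the part in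
    [core a], and the singleton the point [l = lam b]. As [C gam] is arbitrary, the set is cut down
    to [H_ chi]. *)
Let P l i gam : set V := (elts (F l i) `|` elts (C gam) `|` [set l]) `&` H_ chi.

Let hull_ := hull (H_ chi) x en P.

Let W a b : set V := hull_ kappa (generators a b).

Let generators_delta a b : a ∈ muplus -> b ∈ mustar -> generators a b `<=` elts (delta a).
Proof.
move=> amp bs; have ld := lam_delta amp bs.
have succ_delta : elts (succ (lam b)) `<=` elts (delta a).
  by move=> y /mem_succ[yl|->//]; exact: ord_trans (odelta amp) ld yl.
have [ca|nca] := pselect (cf_ge a kappa).
  have [_ [h _] _] := coreP amp ca.
  by rewrite generators_core // => y [/succ_delta//|/h].
by rewrite generators_piece // => y [/succ_delta//|[]].
Qed.

Let delta_H a : a ∈ muplus -> elts (delta a) `<=` H_ chi.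
Proof. by move=> /deltaP[h _ _] y yd; apply: Hmp; exact: ord_trans omp h yd. Qed.

Let kappa_H : elts kappa `<=` H_ chi.
Proof. by move=> y yk; apply: H_ord cchi _; exact: ord_trans (proj1 cchi) kchi yk. Qed.

Let generators_mono a b b' : b ⊆ b' -> b ∈ mustar -> b' ∈ mustar ->
  generators a b `<=` generators a b'.
Proof.
move=> bb' bs b's; have ll := lam_le bb' bs b's.
have succ_mono : elts (succ (lam b)) `<=` elts (succ (lam b')).
  move=> y /mem_succ yl; apply/mem_succ; case: yl => [/ll|->]; first by left.
  by apply: ord_leE => //; exact: olam.
have [ca|nca] := pselect (cf_ge a kappa).
  by rewrite !generators_core // => y [/succ_mono|]; [left|right].
rewrite !generators_piece // => y [/succ_mono|[yd [i /ll il e]]]; [by left|right].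
by split=> //; exists i.
Qed.

Let W_mono a b b' : b ⊆ b' -> b ∈ mustar -> b' ∈ mustar -> W a b `<=` W a b'.
Proof. by move=> *; apply: hull_le_sub; exact: generators_mono. Qed.

Let W_card a b : a ∈ muplus -> b ∈ mustar -> exists2 l, l ∈ mu & W a b #<= elts l.
Proof.
move=> amp bs; have [lbmu klb] := lamP bs.
have [l [S [lmu ll Sl GS]]] : exists l S, [/\ l ∈ mu, lam b ⊆ l, S #<= elts l &
    generators a b = elts (succ (lam b)) `|` S].
  have [ca|nca] := pselect (cf_ge a kappa); last first.
    by exists (lam b), (piece a b); split=> //; exact: generators_piece.
  have [_ _ [b1 b1s h]] := coreP amp ca; have [l1mu _] := lamP b1s.
  (* The bound [lam b1] on the size of [core a] may exceed [lam b], so the larger of the two is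
     taken. *)
  have [l [lmu ? l1l]] := ord_max2 omu lbmu l1mu; exists l, (core a); split=> //.
    by apply: card_le_trans h _; exact: subset_card_le.
  exact: generators_core.
have kl : elts kappa `<=` elts l by move=> y /klb; exact: ll.
have il : infinite_set (elts l) by move=> f; apply: ikappa; exact: sub_finite_set f.
exists l => //; apply: card_hull => //; last exact: subset_card_le.
rewrite GS; apply: card_setU_le => //; rewrite elts_succ; apply: card_setU_le => //.
  exact: subset_card_le.
exact: card_le_trans (countable1 _) ((infiniteP _).1 il).
Qed.

Let W_en a b z i : elts z `<=` H_ chi -> W a b z -> W a b i -> en z i ∈ z -> W a b (en z i).
Proof. by move=> zH Wz Wi e; apply: hull_en => //; exact: zH. Qed.

(** In the case of large cofinality, [y] belongs to some [q] in [core a]; it is [en q i] with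
    [i ∈ mu], and [i] is a generator once [lam b] exceeds it. *)
Let delta_covered a : a ∈ muplus -> elts (delta a) `<=` \bigcup_(b in elts mustar) W a b.
Proof.
move=> amp y yd; have od := odelta amp.
have [ca|nca] := pselect (cf_ge a kappa); last first.
  have [b bs yb] := piece_cov amp yd; exists b => //; apply: sub_hull.
  by rewrite generators_piece //; right.
have [_ [cored coref] _] := coreP amp ca.
have [_ _ lim] := cf_ge_limit rk od (delta_cf_ge amp ca).
have [y' y'd yy'] := lim _ yd; have [q Cq y'q] := coref _ y'd.
have qd := cored _ Cq; have [dmp _ _] := deltaP amp.
have yq := y'q _ yy'.
have [i imu' e] := en_mu (card_below_successor muplusP cmu (ord_trans omp dmp qd)) yq.
have [b bs ib] := lam_mem imu'; exists b => //; rewrite -e; apply: W_en.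
- by move=> t tq; apply: (delta_H amp); exact: ord_trans od qd tq.
- by apply: sub_hull; rewrite generators_core //; right.
- by apply: sub_hull; left; apply/mem_succ; left.
- by rewrite e.
Qed.

(** The row no longer depends on the choice between [core] and [piece]; continuity in [a] is then
    inherited from [delta]. *)
Let row a : a ∈ muplus -> \bigcup_(b in elts mustar) W a b = hull_ kappa (elts (delta a)).
Proof.
move=> amp; apply/seteqP; split=> [y [b bs]|y].
  by apply: hull_le_sub; exact: generators_delta.
move=> /(hull_le_sub (delta_covered amp)) /hull_bigcup[].
- exact: infinite_setN0.
- move=> b b' bs b's; have [h|h] := ord_leVlt (ord_mem ostar bs) (ord_mem ostar b's).
    by exists b' => //; split=> //; exact: W_mono.
  exists b => //; split=> //; apply: W_mono => //.
  exact: ord_mem_sub (ord_mem ostar bs) h.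
- by move=> b bs h; exists b => //; apply: hull_mono h.
Qed.

Let small_hull xi (A : set V) : xi ∈ kappa -> ~ (elts kappa #<= A) ->
  ~ (elts kappa #<= hull_ xi A).
Proof.
move=> xik nA; pose K := A `|` elts xi `|` elts mustar.
have nK : ~ (elts kappa #<= K).
  by do 2?apply: (regular_setU rk) => //; exact: cardinal_lt_card.
move=> h; apply: nK; apply: card_le_trans h _; apply: card_hull.
- by move=> f; apply: istar; apply: sub_finite_set f; right.
- by apply: subset_card_le; left; left.
- by apply: subset_card_le; left; right.
Qed.

(* Failing at every [b < mustar] would give [mustar] many small subsets of
   [core a]; their union is small, hence inside some [C gam], and [gam] lies in
   some [W a b]. *)
Let core_covered a : a ∈ muplus -> cf_ge a kappa -> exists2 b, b ∈ mustar &
  forall Y : set V, Y `<=` core a -> ~ (elts kappa #<= Y) ->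
  exists gam, [/\ W a b gam, Y `<=` elts (C gam) & card_lt (elts (C gam)) (elts kappa)].
Proof.
move=> amp ca; apply: contrapT => nb.
have /choice[Y YP] : forall b, exists Y : set V, b ∈ mustar ->
    [/\ Y `<=` core a, ~ (elts kappa #<= Y) & forall gam, W a b gam ->
      Y `<=` elts (C gam) -> ~ card_lt (elts (C gam)) (elts kappa)].
  move=> b; apply: contrapT => nY; apply: nb; exists b.
    by apply: contrapT => nbs; apply: nY; exists set0.
  move=> Y Yc nk; apply: contrapT => ng; apply: nY; exists Y => _; split=> //.
  by move=> gam Wg YC cC; apply: ng; exists gam.
pose U := \bigcup_(b in elts mustar) Y b.
have nU : ~ (elts kappa #<= U) by apply: (regular_bigcup rk) => // b /YP[].
have [coreC _ _] := coreP amp ca.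
have UE : elts (of_set U) = U.
  by apply: (@of_set_sub _ _ (C (delta a))) => y [b /YP[h _ _] /h]; exact: coreC.
have [_ Dd _] := deltaP amp; have [_ Csq] := CP Dd (delta_cf_ge amp ca).
have [|gam gd [Ug Cg]] := Csq (of_set U).
  split; last by apply/card_ltP; rewrite UE.
  by rewrite /subset_of UE => y [b /YP[h _ _] /h]; exact: coreC.
have [b bs Wg] := delta_covered amp gd.
have [_ _ h] := YP _ bs; apply: (h _ Wg) => // y Yy.
by apply: Ug; rewrite UE; exists b.
Qed.

Let M a b : V := of_set (W a b).

Let ME a b : a ∈ muplus -> b ∈ mustar -> elts (M a b) = W a b.
Proof. by move=> amp bs; have [l _] := W_card amp bs; exact: of_set_small. Qed.

Let M_cofinal a : a ∈ muplus -> cf_ge a kappa ->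
  exists2 b0, b0 ∈ mustar & forall b, b ∈ mustar -> b0 ⊆ b ->
    cofinal (subsets_lt (M a b) kappa) (@subset_of V)
            (subsets_lt (M a b) kappa `&` elts (M a b)).
Proof.
move=> amp ca; have [b0 b0s b0P] := core_covered amp ca; exists b0 => // b bs b0b.
split=> [p []//|p [pM /card_ltP np]].
rewrite /subset_of ME // in pM.
have [xi [A [xik AG nA pA]]] := small_sub_hull rk uncountable pM np.
(* The set [p] is generated at level [xi] by the small set [A], whose two main parts are now covered
   separately, by [F (lam b) i] and by [C gam]. *)
pose A1 := A `&` elts (lam b); pose A2 := A `&` core a.
have nsub (B : set V) : B `<=` A -> ~ (elts kappa #<= B).
  by move=> BA h; apply: nA; apply: card_le_trans h _; exact: subset_card_le.
have A1E : elts (of_set A1) = A1 by apply: (@of_set_sub _ _ (lam b)) => y [].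
have [|i [il [Fl Fk] A1F]] := F_cof bs (p := of_set A1).
  by split; [rewrite /subset_of A1E => y []|apply/card_ltP; rewrite A1E; apply: nsub => y []].
have [||gam [Wg A2g /card_ltP Cg]] := b0P A2.
- by move=> y [].
- by apply: nsub => y [].
have {}Wg : W a b gam by apply: W_mono Wg.
set Q := P (lam b) i gam.
have QH : Q `<=` H_ chi by move=> y [].
have nQ : ~ (elts kappa #<= Q).
  have n : ~ (elts kappa #<= elts (F (lam b) i) `|` elts (C gam) `|` [set lam b]).
    apply: (regular_setU rk); first by apply: (regular_setU rk) => //; exact/card_ltP.
    exact: regular_not_finite rk (finite_set1 _).
  by move=> h; apply: n; apply: card_le_trans h _; apply: subset_card_le => y [].
have xiH : elts xi `<=` H_ chi.
  by move=> y yxi; apply: kappa_H; exact: ord_trans ok xik yxi.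
have AQ : A `<=` Q.
  move=> y Ay; split; last by apply: (delta_H amp); apply: (generators_delta amp bs); exact: AG.
  move: (AG _ Ay); rewrite generators_core // => -[/mem_succ[yl|->]|cy].
  - by left; left; apply: A1F; rewrite A1E.
  - by right.
  - by left; right; exact: A2g.
pose z := cover (H_ chi) x en P xi (lam b) i gam.
have nz := small_hull xik nQ.
have zk : hull_ xi Q #<= elts kappa by case: (card_le_total (hull_ xi Q) (elts kappa)).
have zE : elts z = hull_ xi Q by rewrite /z coverE; exact: of_set_small zk.
have zH : elts z `<=` H_ chi by rewrite zE; exact: hull_sub.
have Hz : H_ chi z.
  apply: H_small => // h; apply: (cardinal_lt_card cchi kchi).
  by apply: card_le_trans h _; rewrite zE.
have Wlam : W a b (lam b) by apply: sub_hull; left; apply/mem_succ; right.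
(* The index [xi] is below [kappa], and the parameters [lam b], [i], [gam] all lie in [W a b]. *)
have Wz : W a b z.
  apply: hull_cover => //; apply: sub_hull; left; apply/mem_succ; left; exact: il.
exists z; last by move=> y /pA; rewrite zE; exact: hull_le_sub.
split; last by rewrite ME.
split; last by apply/card_ltP; rewrite zE.
(* A member of [z] is [en z j] with [j ∈ kappa], and [kappa] is included in [W a b]; so [z] is a
   subset of the model as well as an element. *)
rewrite /subset_of ME // => t tz.
have [|j jk e] := en_kappa (z := z) _ tz; first by rewrite zE.
by rewrite -e; apply: W_en => //; [exact: index_sub_hull|rewrite e].
Qed.

(** A strictly increasing map of ordinals lies above the identity; this puts [muplus] inside the
    union of the rows. *)
Let le_delta a : a ∈ muplus -> a ⊆ delta a.
Proof.
elim/(well_founded_ind (foundation (u := V))): a => a IH amp b ba.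
have bmp := ord_trans omp amp ba.
exact: ord_le_lt_trans (ord_mem omp bmp) (odelta amp) (IH _ ba bmp) (delta_mono ba amp).
Qed.

Lemma matrix_exists : exists N, Jensen_matrix kappa mu muplus mustar chi x N.
Proof.
exists M.
have rowM a : a ∈ muplus ->
    \bigcup_(b in elts mustar) elts (M a b) = hull_ kappa (elts (delta a)).
  by move=> amp; rewrite -row //; apply: eq_bigcupr => b bs; rewrite ME.
split.
- move=> a b amp bs; rewrite ME //.
  have GH : generators a b `<=` H_ chi.
    by move=> y /(generators_delta amp bs); exact: delta_H.
  split.
  + exact: hull_elementary.
  + rewrite -[x ∈ _]/(elts (M a b) x) ME //; exact: hull_default.
  + move=> y [yk|->]; first exact: index_sub_hull.
    have [lmu kl] := lamP bs.
    (* The point [kappa] is at most [lam b], hence a member of [succ (lam b)]. *)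
    apply: sub_hull; left; apply/mem_succ.
    have [|<-] := ord_leE ok (olam bs) kl; [by left|by right].
  + have [l lmu h] := W_card amp bs; apply/card_ltP => h'.
    exact: cardinal_lt_card cmu lmu (card_le_trans h' h).
- move=> a b b' amp b's bb'; have bs := ord_trans ostar b's bb'.
  rewrite /subset_of !ME //; apply: W_mono => //.
  exact: ord_mem_sub (ord_mem ostar b's) bb'.
- exact: M_cofinal.
split.
- move=> a a' a'mp aa'; have amp := ord_trans omp a'mp aa'.
  rewrite !rowM //; apply: hull_le_sub; apply: ord_mem_sub; first exact: odelta.
  exact: delta_mono.
- move=> a amp la; rewrite rowM //.
  have -> : \bigcup_(a' in elts a) \bigcup_(b in elts mustar) elts (M a' b) =
      \bigcup_(a' in elts a) hull_ kappa (elts (delta a')).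
    by apply: eq_bigcupr => a' a'a; rewrite rowM //; exact: ord_trans a'a.
  (* At a limit, [delta a] is an increasing union, and hulls commute with directed unions. *)
  rewrite delta_limit //; have [oa a0 _] := la.
  apply/seteqP; split=> y; last first.
    by move=> [a' a'a]; apply: hull_le_sub => t td; exists a'.
  apply: hull_bigcup => // b b' ba b'a.
  have le c c' : c ∈ c' -> c' ∈ a -> delta c ⊆ delta c'.
    move=> cc' c'a; have c'mp := ord_trans omp amp c'a.
    by apply: ord_mem_sub; [exact: odelta|exact: delta_mono].
  have [h|<-|h] := ord_total (ord_mem oa ba) (ord_mem oa b'a).
  + by exists b' => //; split=> //; exact: le.
  + by exists b; [|split].
  + by exists b => //; split=> //; exact: le.
- move=> a amp; have smp := successor_limit muplusP imu amp.
  exists (succ a) => //; rewrite rowM //; apply: sub_hull.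
  by apply: le_delta => //; apply/mem_succ; right.
Qed.
End Matrix.

(** * Choice of the data from the hypotheses *)

Theorem theorem2p4 (V : universe) (kappa mu muplus mustar : V)
  (kappa_regular : is_regular kappa)
  (mu_cardinal : is_cardinal mu)
  (kappa_lt_mu : kappa ∈ mu)
  (muplusP : is_successor_cardinal mu muplus)
  (mustarP : is_cf mu mustar)
  (cf_mu_lt_kappa : mustar ∈ kappa)
  (cf_subsets : forall nu : V, nu ∈ mu ->
     exists lambda : V, [/\ nu ⊆ lambda, lambda ∈ mu &
       is_cof (subsets_lt lambda kappa) (@subset_of V) lambda])
  (square : square3 kappa muplus) :
  exists chi0 : V, is_cardinal chi0 /\
    forall chi : V, is_regular chi -> chi0 ⊆ chi ->
    forall x : V, H_ chi x ->
    exists M : V -> V -> V, Jensen_matrix kappa mu muplus mustar chi x M.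
Proof.
have [cmp mump _] := muplusP.
have imu : infinite_set (elts mu).
  have [_ ikappa _] := kappa_regular.
  move=> f; apply: ikappa; apply: sub_finite_set f.
  exact: ord_mem_sub (proj1 mu_cardinal) kappa_lt_mu.
(* From [muplus] on, all ordinals below [muplus], and so all generators, belong to [H_ chi]. *)
exists muplus; split=> // chi chi_regular mpchi x Hx.
have [C [D [clubD CP]]] := square.
have [|f [fP f_mono f_cof]] := @cofinal_sequence V mu mustar
    (fun l => kappa ⊆ l /\ is_cof (subsets_lt l kappa) (@subset_of V) l)
    (proj1 mu_cardinal) mustarP.
  move=> b bmu; have [c [cmu bc kc]] := ord_max2 (proj1 mu_cardinal) bmu kappa_lt_mu.
  have [l [cl lmu Ql]] := cf_subsets _ cmu; exists l; split=> //.
    by move=> z /bc; exact: cl.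
  by split=> // z /kc; exact: cl.
have [delta [deltaP delta_mono delta_limit]] :=
  club_enumeration muplusP mu_cardinal imu clubD.
(* A single enumeration of [z] has to serve both bounds: one indexed by [kappa] is also indexed by
   [mu]. *)
have /choice[en enP] : forall z, exists e : V -> V,
    (elts z #<= elts kappa -> forall t, t ∈ z -> exists2 i, i ∈ kappa & e i = t) /\
    (elts z #<= elts mu -> forall t, t ∈ z -> exists2 i, i ∈ mu & e i = t).
  move=> z; have [zk|nzk] := pselect (elts z #<= elts kappa).
    have [e eP] := card_le_surj zk; exists e; split=> // _ t /eP[i ik <-].
    by exists i => //; exact: ord_trans (proj1 mu_cardinal) kappa_lt_mu ik.
  have [zm|nzm] := pselect (elts z #<= elts mu); last by exists id; split.
  by have [e eP] := card_le_surj zm; exists e; split.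
have /choice[F FP] : forall l, exists F : V -> V,
    is_cof (subsets_lt l kappa) (@subset_of V) l ->
    forall p, subsets_lt l kappa p ->
      exists i, [/\ i ∈ l, subsets_lt l kappa (F i) & p ⊆ F i].
  move=> l; have [cl|n] := pselect (is_cof (subsets_lt l kappa) (@subset_of V) l).
    by have [F FP] := cofinal_enum cl; exists F.
  by exists id.
apply: (@matrix_exists V kappa mu muplus mustar chi x kappa_regular mu_cardinal
  kappa_lt_mu muplusP mustarP cf_mu_lt_kappa chi_regular mpchi Hx C D CP f delta en F) => //.
- by move=> b /fP[? []].
- by move=> b /fP[_ [_ /FP]].
- by move=> z; case: (enP z).
- by move=> z; case: (enP z).
Qed.
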